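(* Let $0<\gamma<1$, $\kappa_\gamma>0$, $\lambda\ge 0$, let $x_l<x_r$ be real numbers, put $\Omega_i=(x_l,x_r)$, and let $u_0$ be a real-valued function whose support is contained in $\Omega_i$. Let $u(x,t)$ be a real-valued solution (with the regularity described in the context) of the initial-boundary value problem $$\frac{\partial u(x,t)}{\partial t}=\kappa_\gamma\, {}_{0}D_t^{1-\gamma,\lambda}\big(u_{xx}\big)(x,t)-\lambda u(x,t),\qquad x\in\Omega_i,\ t>0,$$ $$u(x,0)=u_0(x),\qquad x\in\Omega_i,$$ $$u_x(x_l,t)=\frac{1}{\sqrt{\kappa_\gamma}}\,{}_{0}^{C}D_t^{\frac{\gamma}{2},\lambda}u(x_l,t),\qquad u_x(x_r,t)=-\frac{1}{\sqrt{\kappa_\gamma}}\,{}_{0}^{C}D_t^{\frac{\gamma}{2},\lambda}u(x_r,t),\qquad t>0.$$ Then for every $s_0>0$, $$\int_0^{+\infty}e^{-2s_0t}\,\|u(\cdot,t)\|^2\,dt\le\frac{1}{2s_0}\|u_0\|^2 .$$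
   Context: Here $\|w\|^2=\int_{\Omega_i}w(x)^2\,dx$ is the squared $L^2(\Omega_i)$ norm. All fractional operators act in the variable $t$. For $0<\alpha<1$ and $\lambda\in\mathbb{R}$, the Riemann-Liouville tempered fractional derivative is $${}_{0}D_t^{\alpha,\lambda}f(t)=\frac{e^{-\lambda t}}{\Gamma(1-\alpha)}\frac{d}{dt}\int_0^t\frac{e^{\lambda s}f(s)}{(t-s)^{\alpha}}\,ds,$$ and the Caputo tempered fractional derivative is $${}_{0}^{C}D_t^{\alpha,\lambda}f(t)=\frac{e^{-\lambda t}}{\Gamma(1-\alpha)}\int_0^t\frac{1}{(t-s)^{\alpha}}\frac{d\big(e^{\lambda s}f(s)\big)}{ds}\,ds .$$ Regularity convention: $u$, $u_x$, $u_{xx}$ are continuous on $[x_l,x_r]\times[0,\infty)$; $u_t$ exists and is continuous on $[x_l,x_r]\times(0,\infty)$, with $\sup_{x\in[x_l,x_r]}|u_t(x,t)|\le g(t)$ for some $g$ that is integrable on $(0,T)$ for every $T>0$; all fractional derivatives appearing in the problem exist, and the equations hold pointwise. The initial condition extends to the closed interval by continuity, so $u(x_l,0)=u(x_r,0)=0$ because $u_0$ is supported in $\Omega_i$. *)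

(* Defs.v *)
From HB Require Import structures.
From mathcomp Require Import all_boot all_order all_algebra.
From mathcomp Require Import all_classical all_reals all_analysis.
Set Implicit Arguments.
Unset Strict Implicit.
Unset Printing Implicit Defensive.
Import Order.TTheory GRing.Theory Num.Theory.
Import numFieldNormedType.Exports.
Local Open Scope classical_set_scope.
Local Open Scope ring_scope.

Section Defs.
Context {R : realType}.
Local Notation mu := (@lebesgue_measure R).
Implicit Types (A : set R) (f w : R -> R) (u : R -> R -> R).
Implicit Types (a alpha lambda x t xl xr : R).

(* Euler's Gamma function, for a > 0 (junk value otherwise). *)
Definition Gamma a : R := \int[mu]_(x in `]0, +oo[) (x `^ (a - 1) * expR (- x)).

(* Derivative relative to A: two-sided at interior points of A, one-sided at
   the endpoints of an interval. *)
Definition diff_quot f x : R -> R := fun y => (f y - f x) / (y - x).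
Definition derivable_within A f x : Prop := cvg (diff_quot f x @ within A x^').
Definition derive_within A f x : R := lim (diff_quot f x @ within A x^').

Definition RL_integrand alpha lambda f t : R -> R :=
  fun s => expR (lambda * s) * f s / (t - s) `^ alpha.

Definition RL_integral alpha lambda f : R -> R :=
  fun t => \int[mu]_(s in `]0, t[) RL_integrand alpha lambda f t s.

Definition RL_tempered alpha lambda f t : R :=
  expR (- (lambda * t)) / Gamma (1 - alpha) *
  derive1 (RL_integral alpha lambda f) t.

(* Integrability is required since a divergent integral has a junk value. *)
Definition RL_tempered_exists alpha lambda f t : Prop :=
  (\forall r \near t,
     mu.-integrable `]0, r[ (EFin \o RL_integrand alpha lambda f r)) /\
  derivable (RL_integral alpha lambda f) t 1.

Definition Caputo_integrand alpha lambda f t : R -> R :=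
  fun s => derive1 (fun r => expR (lambda * r) * f r) s / (t - s) `^ alpha.

Definition Caputo_tempered alpha lambda f t : R :=
  expR (- (lambda * t)) / Gamma (1 - alpha) *
  \int[mu]_(s in `]0, t[) Caputo_integrand alpha lambda f t s.

Definition Caputo_tempered_exists alpha lambda f t : Prop :=
  {in `]0, t[, forall s, derivable (fun r => expR (lambda * r) * f r) s 1} /\
  mu.-integrable `]0, t[ (EFin \o Caputo_integrand alpha lambda f t).

(* Only the values of u on [xl, xr] x [0, +oo[ matter; at x = xl and x = xr
   the space derivatives are one-sided. *)
Definition dx xl xr u x t : R := derive_within `[xl, xr] (u ^~ t) x.
Definition dxx xl xr u x t : R := dx xl xr (dx xl xr u) x t.
Definition dt u x t : R := derive1 (u x) t.

Record spacetime_regular xl xr u : Prop := Regular {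
  regular_dx : forall x t, x \in `[xl, xr] -> 0 <= t ->
    derivable_within `[xl, xr] (u ^~ t) x;
  regular_dxx : forall x t, x \in `[xl, xr] -> 0 <= t ->
    derivable_within `[xl, xr] ((dx xl xr u) ^~ t) x;
  regular_cont :
    {within `[xl, xr] `*` `[0, +oo[, continuous (fun p => u p.1 p.2)};
  regular_dx_cont :
    {within `[xl, xr] `*` `[0, +oo[, continuous (fun p => dx xl xr u p.1 p.2)};
  regular_dxx_cont :
    {within `[xl, xr] `*` `[0, +oo[, continuous (fun p => dxx xl xr u p.1 p.2)};
  regular_dt : forall x t, x \in `[xl, xr] -> 0 < t -> derivable (u x) t 1;
  regular_dt_cont :
    {within `[xl, xr] `*` `]0, +oo[, continuous (fun p => dt u p.1 p.2)};
  regular_dt_bound : exists g : R -> R,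
    (forall T, 0 < T -> mu.-integrable `]0, T[ (EFin \o g)) /\
    (forall x t, x \in `[xl, xr] -> 0 < t -> `|dt u x t| <= g t)
}.

Definition closed_support f : set R := closure [set x | f x != 0].

(* Squared L^2(]xl, xr[) norm, possibly +oo. *)
Definition sqnormL2 xl xr w : \bar R :=
  (\int[mu]_(x in `]xl, xr[) (w x ^+ 2)%:E)%E.

End Defs.

(* Main.v *)
(* No Laplace transform is used: in fact the L2 norm of u(., T) is bounded by that
   of u0 for every T, and integrating against exp (- 2 s0 t) gives the theorem.

   Put v = exp (lambda t) u, which removes the tempering. Integrating the equation
   in time gives the Volterra equation v - v(., 0) = c k * v_xx, where
   k(t) = t^(gamma - 1) and c = kappa / Gamma(gamma). With l(t) = t^(- gamma), the
   convolution l * k is a constant B, so l * v_t = c B v_xx. The pointwise inequality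
   2 v (l * v_t) >= l * (v^2)_t then turns this, after convolution with k, into
   (v(T)^2 - v(0)^2) / 2 <= c (k * (v v_xx))(T).
   Integrating in x and by parts leaves the flux terms c k * [v v_x]. There v_x is
   a nonnegative multiple of -/+ m * v_t with m(t) = t^(- gamma / 2); the same pointwise
   inequality for m, and the fact that k * m is a nonnegative multiple of the
   nondecreasing function t^(gamma / 2), show that the flux terms are nonpositive,
   because v vanishes at the endpoints at time 0. Only the sign of Gamma matters. *)
Require Import Defs.
From HB Require Import structures.
From mathcomp Require Import all_boot all_order all_algebra.
From mathcomp Require Import all_classical all_reals all_analysis.
From mathcomp Require Import measurable_realfun ring lra.
Import Order.TTheory GRing.Theory Num.Theory.
Import numFieldNormedType.Exports.
Local Open Scope classical_set_scope.
Local Open Scope ring_scope.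

Set Implicit Arguments.
Unset Strict Implicit.
Unset Printing Implicit Defensive.

(** * Fundamental theorem of calculus with unbounded integrands; integrability of power kernels *)

Section calculus.
Context {R : realType}.
Local Notation mu := (@lebesgue_measure R).
Implicit Types (f F q g : R -> R) (a b c t : R).

(** The limited regularity in time shapes the argument. Only a convolution of [v_xx] is known to be
    differentiable in time, while [v_xx] itself is merely continuous; passing to the integrated
    equation avoids differentiating it. On the other side [v_t] may blow up at time 0, as t^(gamma -
    1) does, so every integration by parts must tolerate an integrand that is only integrable at 0,
    and a kernel that is singular at the other end. The fundamental theorem of calculus is therefore
    used as an inequality: the terms that contain the derivative of a kernel, or the square of
    [v_x], have a sign and are discarded before anything is integrated. The identity for l * v_t is
    obtained by comparing primitives, hence only for almost every time. This is enough, because it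
    is used only under the convolution with k. That outer convolution also keeps the final time T
    visible, which turns integral information into a bound at each single time. *)

Lemma integrable_itvoo_cc f a b : mu.-integrable `]a, b[ (EFin \o f) ->
  mu.-integrable `[a, b] (EFin \o f).
Proof.
move=> /integrableP[mf fi].
apply/integrableP; split; first exact: emeasurable_fun_itv_cc mf.
by rewrite integral_itv_bndoo//; exact: measurableT_comp.
Qed.

Lemma Rintegral_itvoo_cc f a b : measurable_fun `]a, b[ f ->
  \int[mu]_(x in `[a, b]) f x = \int[mu]_(x in `]a, b[) f x.
Proof.
by move=> mf; rewrite /Rintegral integral_itv_bndoo//; exact/measurable_EFinP.
Qed.

(* The integral of q up to x, minus F x, is nondecreasing; q may be unbounded near
   the endpoints. *)
Lemma FTC_le_Rintegral F dF q a b : a < b ->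
  mu.-integrable `]a, b[ (EFin \o q) ->
  (forall x, x \in `]a, b[ -> {for x, continuous q}) ->
  {within `[a, b], continuous F} ->
  (forall x, x \in `]a, b[ -> is_derive x 1 F (dF x)) ->
  (forall x, x \in `]a, b[ -> dF x <= q x) ->
  F b - F a <= \int[mu]_(x in `]a, b[) q x.
Proof.
move=> ab qi cq cF dFE dFq.
have qi' := integrable_itvoo_cc qi.
pose P x := \int[mu]_(t in `[a, x]) q t.
have cP : {within `[a, b], continuous P}.
  exact: parameterized_integral_continuous (ltW ab) qi'.
have dP x : x \in `]a, b[ -> is_derive x 1 P (q x).
  move=> xab; have /itvP xi := xab.
  have xb : x < b by rewrite xi.
  have ax : a < x by rewrite xi.
  have [dPx dPE] := continuous_FTC1_closed xb qi' ax (cq _ xab).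
  by apply: DeriveDef; [exact: dPx|rewrite -derive1E].
have dG x : x \in `]a, b[ -> is_derive x 1 (P \- F) (q x - dF x).
  by move=> xab; apply: is_deriveB; [exact: dP|exact: dFE].
have : (P \- F) a <= (P \- F) b.
  have cPF : {within `[a, b], continuous (P \- F)}.
    by move=> x; apply: continuousB; [exact: cP|exact: cF].
  have dPF x : x \in `]a, b[ -> derivable (P \- F) x 1 by move=> /dG[].
  have dPF0 x : x \in `]a, b[ -> 0 <= derive1 (P \- F) x.
    move=> xab; rewrite derive1E; have [_ ->] := dG _ xab.
    by rewrite subr_ge0 dFq.
  apply: (ger0_derive1_le_cc dPF dPF0 cPF) => //; last exact: ltW.
  - by rewrite in_itv/= lexx ltW.
  - by rewrite in_itv/= lexx ltW.
rewrite /= /P set_itv1 Rintegral_set1 Rintegral_itvoo_cc; last first.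
  by have /integrableP[/measurable_EFinP] := qi.
by move=> h; lra.
Qed.

(** The one-sided version applied to F and q, and again to their opposites. *)
Lemma FTC_Rintegral F q a b : a < b ->
  mu.-integrable `]a, b[ (EFin \o q) ->
  (forall x, x \in `]a, b[ -> {for x, continuous q}) ->
  {within `[a, b], continuous F} ->
  (forall x, x \in `]a, b[ -> is_derive x 1 F (q x)) ->
  \int[mu]_(x in `]a, b[) q x = F b - F a.
Proof.
move=> ab qi cq cF dF; apply/eqP; rewrite eq_le (FTC_le_Rintegral ab qi cq cF dF)//.
rewrite andbT -lerN2.
have -> : - (\int[mu]_(x in `]a, b[) q x) = \int[mu]_(x in `]a, b[) (\- q) x.
  by rewrite -mulN1r -RintegralZl//; apply: eq_Rintegral => x _; rewrite mulN1r.
have -> : - (F b - F a) = (\- F) b - (\- F) a by rewrite /= opprB opprK addrC.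
apply: (@FTC_le_Rintegral _ (\- q)); first exact: ab.
- exact: (integrableN qi).
- by move=> x /cq; exact: cvgN.
- by move=> x; apply: continuousN; exact: cF.
- by move=> x xab; apply: is_deriveN; exact: dF.
- by move=> x _; exact: lexx.
Qed.

Lemma continuous_powRV b t : 0 < t -> {for t, continuous (fun r => (r `^ b)^-1)}.
Proof.
move=> t0; apply: continuousV; first by rewrite gt_eqF ?powR_gt0.
apply: differentiable_continuous; apply/derivable1_diffP.
by apply: derivable_powR; rewrite in_itv/= andbT.
Qed.

Lemma measurable_powRV b : measurable_fun setT (fun r : R => (r `^ b)^-1).
Proof. by under eq_fun do rewrite -powRN; exact: measurable_powR. Qed.

(** Monotone convergence along intervals that start at 1/(n+1). On each of them the antiderivative
    r^(1-b)/(1-b) is regular, and it bounds the integral by T^(1-b)/(1-b), uniformly in n. *)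
Lemma integrable_powRV b T : b < 1 ->
  mu.-integrable `]0, T[ (EFin \o (fun r => (r `^ b)^-1)).
Proof.
move=> b1; have [T0|T0] := leP T 0.
  rewrite set_itv_ge ?bnd_simp -?leNgt//; exact: integrable_set0.
have mk := measurable_powRV b.
apply/integrableP; split; first by apply/measurable_EFinP; exact: measurable_funTS.
under eq_integral do rewrite /= ger0_norm ?invr_ge0 ?powR_ge0//.
rewrite itv_open_bnd_bigcup.
set F := fun n : nat => _.
have FT n x : F n x -> 0 < x.
  by rewrite /F/= in_itv/= add0r => /andP[+ _]; apply: lt_le_trans; rewrite invr_gt0.
have cF : (\int[mu]_(x in F i) (x `^ b)^-1%:E @[i --> \oo] -->
        \int[mu]_(x in \bigcup_i F i) (x `^ b)^-1%:E)%E.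
  apply: ge0_nondecreasing_set_cvg_integral => //.
  - apply/nondecreasing_seqP => n; apply/subsetPset; apply: subset_itvr.
    by rewrite bnd_simp !add0r lef_pV2 ?posrE// ler_nat.
  - by move=> i; exact: measurable_itv.
  - by move=> i; apply/measurable_EFinP; exact: measurable_funTS.
  - by move=> i x _; rewrite lee_fin invr_ge0 powR_ge0.
move: (cF) => /(@cvg_lim _ (@ereal_hausdorff R)) <-.
apply: (@le_lt_trans _ _ ((1 - b)^-1 * T `^ (1 - b))%:E); last exact: ltry.
apply: lime_le; first by apply/cvg_ex; eexists; exact: cF.
apply: nearW => n; rewrite /F.
have rT : 0 <= (1 - b)^-1 * T `^ (1 - b).
  by rewrite mulr_ge0 ?powR_ge0// invr_ge0 subr_ge0 ltW.
have s0 : 0 < 0 + n.+1%:R^-1 :> R by rewrite add0r invr_gt0.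
set s := 0 + n.+1%:R^-1 in s0 *.
have [Ts|sT] := leP T s.
  by rewrite set_itv_ge ?bnd_simp -?leNgt// integral_set0 lee_fin.
have dP x : x \in `[s, T] -> is_derive x 1 (fun r => (1 - b)^-1 * r `^ (1 - b)) (x `^ b)^-1.
  rewrite in_itv/= => /andP[sx _]; have x0 := lt_le_trans s0 sx.
  have -> : (x `^ b)^-1 = (1 - b)^-1 *: ((1 - b) * x `^ ((1 - b) - 1)).
    have -> : 1 - b - 1 = - b by ring.
    by rewrite /GRing.scale/= mulrA mulVf ?mul1r ?powRN// subr_eq0 gt_eqF.
  by apply: is_deriveZ; exact: is_derive1_powR.
have cV : {within `[s, T], continuous (fun r => (r `^ b)^-1)}.
  apply: continuous_in_subspaceT => x; rewrite inE/= in_itv/= => /andP[sx _].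
  by apply: continuous_powRV; exact: lt_le_trans sx.
have mE : measurable_fun `]s, T[ (fun x => (x `^ b)^-1%:E).
  by apply/measurable_EFinP; exact: measurable_funTS.
rewrite integral_itv_bndoo// -(integral_itv_bndoo true false)//.
rewrite (@continuous_FTC2 _ _ (fun r => (1 - b)^-1 * r `^ (1 - b)))//.
- rewrite -EFinB lee_fin gerBl mulr_ge0 ?powR_ge0// invr_ge0 subr_ge0 ltW//.
- have : {within `[s, T], continuous (fun r => (1 - b)^-1 * r `^ (1 - b))}.
    by apply: derivable_within_continuous => x /dP[].
  move=> /(continuous_within_itvP _ sT)[_ ? ?]; split => // x xsT.
  by have [] := dP _ (subset_itv_oo_cc xsT).
- by move=> x xsT; rewrite derive1E; have [_ ->] := dP _ (subset_itv_oo_cc xsT).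
Qed.
End calculus.

(** * Affine change of variables for Lebesgue measure *)

Section affine_substitution.
Context {R : realType}.
Local Notation mu := (@lebesgue_measure R).
Implicit Types (c d : R).

Lemma measurable_affine c d : measurable_fun setT (fun x : R => c * x + d).
Proof. by apply: measurable_funD => //; apply: measurable_funM. Qed.

(** Lebesgue measure is determined by its values on intervals []p, q]], so it suffices to compare
    there. For c < 0 the preimage is closed on the other side, hence the two cases. *)
Lemma lebesgue_measure_affine c d (A : set R) : c != 0 -> measurable A ->
  (`|c|%:E * mu ((fun x : R => c * x + d)%R @^-1` A) = mu A)%E.
Proof.
move=> c0 mA.
pose h : measurableTypeR R -> measurableTypeR R := fun x : R => c * x + d.
have mh : measurable_fun setT h by exact: measurable_affine.
pose pf := [the {measure set (measurableTypeR R) -> \bar R} of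
  measure_function_pushforward__canonical__measure_function_Measure mu mh].
pose nu := mscale (NngNum (normr_ge0 c)) pf.
apply/esym; rewrite [RHS](_ : _ = nu A)//.
apply: lebesgue_measure_unique => // _ [[p q]] _ <-.
rewrite [RHS](_ : _ = (`|c|%:E * mu (h @^-1` `]p, q]))%E)//.
have [c1|c1|c1] := ltgtP c 0; last by rewrite c1 eqxx in c0.
- have -> : h @^-1` `]p, q] = `[(q - d) / c, (p - d) / c[%classic.
    apply/seteqP; split => x; rewrite /h/= !in_itv/= ler_ndivrMr// ltr_ndivlMr//.
      by move=> /andP[? ?]; apply/andP; split; lra.
    by move=> /andP[? ?]; apply/andP; split; lra.
  rewrite !lebesgue_measure_itv/= !lte_fin ltr_ndivlMr// divfK ?lt_eqF// ltrD2r.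
  case: ifPn => _; last by rewrite mule0.
  by rewrite -!EFinB -EFinM ltr0_norm//; congr EFin; field.
- have -> : h @^-1` `]p, q] = `](p - d) / c, (q - d) / c]%classic.
    apply/seteqP; split => x; rewrite /h/= !in_itv/= ltr_pdivrMr// ler_pdivlMr//.
      by move=> /andP[? ?]; apply/andP; split; lra.
    by move=> /andP[? ?]; apply/andP; split; lra.
  rewrite !lebesgue_measure_itv/= !lte_fin ltr_pdivrMr// divfK ?gt_eqF// ltrD2r.
  case: ifPn => _; last by rewrite mule0.
  by rewrite -!EFinB -EFinM gtr0_norm//; congr EFin; field.
Qed.

Lemma ge0_integral_affine c d (f : R -> \bar R) : c != 0 ->
  measurable_fun setT f -> (forall x, 0 <= f x)%E ->
  (\int[mu]_x f x = `|c|%:E * \int[mu]_x f (c * x + d)%R)%E.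
Proof.
move=> c0 mf f0.
pose h : measurableTypeR R -> measurableTypeR R := fun x : R => c * x + d.
have mh : measurable_fun setT h by exact: measurable_affine.
have := @ge0_integral_pushforward _ _ _ _ R h mh [the measure _ _ of mu] setT f measurableT mf.
rewrite preimage_setT => <-; last by move=> x _; exact: f0.
rewrite -(@ge0_integral_mscale _ _ _ 
  (measure_function_pushforward__canonical__measure_function_Measure mu mh)
  setT measurableT (NngNum (normr_ge0 c)) f mf)//.
apply: eq_measure_integral => A mA _.
exact/esym/(lebesgue_measure_affine d c0 mA).
Qed.

End affine_substitution.

(** * Composition of Abel kernels *)

Section kernels.
Context {R : realType}.
Local Notation mu := (@lebesgue_measure R).
Implicit Types (a b s t r T tau : R) (g : R -> R).

(* Extended by 0 so that convolutions on ]0, t[ become integrals over R. *)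
Definition kern b tau : R := if 0 < tau then (tau `^ b)^-1 else 0.

Lemma kern_ge0 b tau : 0 <= kern b tau.
Proof. by rewrite /kern; case: ifP => // _; rewrite invr_ge0 powR_ge0. Qed.

Lemma kern_le0 b tau : tau <= 0 -> kern b tau = 0.
Proof. by rewrite /kern leNgt; case: ifP. Qed.

Lemma kernE b tau : 0 < tau -> kern b tau = (tau `^ b)^-1.
Proof. by rewrite /kern => ->. Qed.

Lemma kernM b tau r : 0 < tau -> kern b (tau * r) = kern b tau * kern b r.
Proof.
move=> tau0; have [r0|r0] := leP r 0.
  by rewrite [kern _ r]kern_le0// kern_le0 ?mulr0// pmulr_rle0.
by rewrite !kernE ?mulr_gt0// powRM ?ltW// invfM.
Qed.

(** Bounds the factor that stays away from its singularity when the beta integral is cut at 1/2; as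
    b is at most 1, the constant 2 serves all exponents. *)
Lemma kern_le b tau : 0 <= b <= 1 -> 1 / 2 <= tau -> kern b tau <= 2.
Proof.
move=> /andP[b0 b1] tau2; have tau0 : 0 < tau by lra.
rewrite kernE// -[leRHS]invrK lef_pV2 ?posrE ?powR_gt0 ?invr_gt0//.
apply: (@le_trans _ _ ((2^-1) `^ b)).
  by apply: ger1_powR => //; apply/andP; split; lra.
by apply: ge0_ler_powR; rewrite ?nnegrE//; lra.
Qed.

Lemma measurable_kern b : measurable_fun setT (kern b).
Proof.
apply: measurable_fun_ifT => //; first exact: measurable_fun_ltr.
exact: measurable_powRV.
Qed.

Definition kern2 a b tau r : R := kern a (tau - r) * kern b r.

Lemma kern2_ge0 a b tau r : 0 <= kern2 a b tau r.
Proof. by rewrite mulr_ge0 ?kern_ge0. Qed.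

Lemma measurable_kern2 a b tau : measurable_fun setT (kern2 a b tau).
Proof.
apply: measurable_funM; last exact: measurable_kern.
apply: (measurableT_comp (measurable_kern a)).
exact: measurable_funB.
Qed.

(** The convolution of two kernels, kept in the extended reals so that it can be reflected, shifted
    and rescaled before it is known to be finite. *)
Definition ebeta a b tau : \bar R := (\int[mu]_r (kern2 a b tau r)%:E)%E.

Lemma ebetaC a b tau : ebeta a b tau = ebeta b a tau.
Proof.
rewrite /ebeta (@ge0_integral_affine _ (-1) tau); first last.
- by move=> r; rewrite lee_fin kern2_ge0.
- by apply/measurable_EFinP; exact: measurable_kern2.
- by rewrite oppr_eq0 oner_eq0.
rewrite normrN1 mul1e; apply: eq_integral => r _; congr EFin.
by rewrite /kern2 mulrC; congr (kern _ _ * kern _ _); ring.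
Qed.

Lemma ebeta_shift a b s T :
  (\int[mu]_t (kern a (T - t) * kern b (t - s))%:E = ebeta a b (T - s))%E.
Proof.
rewrite (@ge0_integral_affine _ 1 s); first last.
- by move=> r; rewrite lee_fin mulr_ge0 ?kern_ge0.
- apply/measurable_EFinP; apply: measurable_funM.
    by apply: (measurableT_comp (measurable_kern a)); exact: measurable_funB.
  by apply: (measurableT_comp (measurable_kern b)); exact: measurable_funB.
- by rewrite oner_eq0.
rewrite normr1 mul1e; apply: eq_integral => r _; congr EFin.
by rewrite /kern2; congr (kern _ _ * kern _ _); ring.
Qed.

(** Homogeneity: the kernels have degrees -a and -b, and the substitution r -> tau r contributes
    1. *)
Lemma ebeta_scale a b tau : 0 < tau ->
  (ebeta a b tau = (tau `^ (1 - a - b))%:E * ebeta a b 1)%E.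
Proof.
move=> tau0; rewrite /ebeta (@ge0_integral_affine _ tau 0); first last.
- by move=> r; rewrite lee_fin kern2_ge0.
- by apply/measurable_EFinP; exact: measurable_kern2.
- by rewrite gt_eqF.
have k0 (t : R) r : (0 <= (kern2 a b t r)%:E)%E by rewrite lee_fin kern2_ge0.
rewrite -[LHS]ge0_integralZl; first last.
- by rewrite lee_fin normr_ge0.
- by move=> r _; exact: k0.
- apply/measurable_EFinP; apply: (measurableT_comp (measurable_kern2 a b tau)).
  exact: measurable_affine.
- exact: measurableT.
rewrite -[RHS]ge0_integralZl; first last.
- by rewrite lee_fin powR_ge0.
- by move=> r _; exact: k0.
- by apply/measurable_EFinP; exact: measurable_kern2.
- exact: measurableT.
apply: eq_integral => r _; rewrite -!EFinM; congr EFin.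
rewrite addr0 gtr0_norm// /kern2.
have -> : tau - tau * r = tau * (1 - r) by ring.
rewrite !kernM// (kernE a)// (kernE b)//.
have t0 : tau != 0 by rewrite gt_eqF.
by rewrite !powRB ?t0 ?implybT// powRr1 ?ltW//; ring.
Qed.

(** On each half of the unit interval one factor is at most 2, and the other is an integrable power
    with its singularity at the near endpoint. *)
Lemma kern2_1_le a b r : 0 <= a < 1 -> 0 <= b < 1 ->
  kern2 a b 1 r <= 2 * (fun r => (r `^ b)^-1) \_ `]0, 1[ r
                   + 2 * (fun r => (r `^ a)^-1) \_ `]0, 1[ (1 - r).
Proof.
move=> /andP[a0 a1] /andP[b0 b1]; rewrite /kern2.
have p0 c x : 0 <= ((fun r : R => (r `^ c)^-1) \_ `]0, 1[) x.
  by rewrite patchE; case: ifP => // _; rewrite invr_ge0 powR_ge0.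
have [r0|r0] := leP r 0; first by rewrite (kern_le0 b)// mulr0 addr_ge0 ?mulr_ge0.
have [r1|r1] := leP 1 r.
  by rewrite (@kern_le0 a) ?mul0r ?addr_ge0 ?mulr_ge0// subr_le0.
have kp c x : 0 < x < 1 -> ((fun r : R => (r `^ c)^-1) \_ `]0, 1[) x = kern c x.
  move=> /andP[x0 x1]; rewrite patchE mem_set ?kernE//=.
  by rewrite in_itv/= x0 x1.
rewrite !kp; try (by apply/andP; split; lra).
have [r2|r2] := leP r (1/2).
  have := @kern_le a (1 - r) _ _; rewrite a0 ltW// => /(_ isT) h.
  have {}h : kern a (1 - r) <= 2 by apply: h; lra.
  by have := ler_wpM2r (kern_ge0 b r) h; have := kern_ge0 a (1 - r); lra.
have := @kern_le b r _ _; rewrite b0 ltW// => /(_ isT) h.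
have {}h : kern b r <= 2 by apply: h; lra.
by have := ler_wpM2l (kern_ge0 a (1 - r)) h; have := kern_ge0 b r; lra.
Qed.

Lemma ebeta1_lty a b : 0 <= a < 1 -> 0 <= b < 1 -> (ebeta a b 1 < +oo)%E.
Proof.
move=> a01 b01.
have mp c : measurable_fun setT ((fun r : R => (r `^ c)^-1) \_ `]0, 1[).
  by apply/(measurable_restrictT _ _).1 => //; apply: measurable_funTS; exact: measurable_powRV.
have p0 c x : 0 <= ((fun r : R => (r `^ c)^-1) \_ `]0, 1[) x.
  by rewrite patchE; case: ifP => // _; rewrite invr_ge0 powR_ge0.
have ip c : 0 <= c < 1 -> (\int[mu]_r ((fun r => (r `^ c)^-1) \_ `]0%R, 1%R[ r)%:E < +oo)%E.
  move=> /andP[_ c1].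
  have := integrable_powRV 1 c1; rewrite integrable_mkcond//=.
  rewrite restrict_EFin.
  move=> /integrableP[_]; apply: le_lt_trans; rewrite le_eqVlt; apply/orP; left; apply/eqP.
  by apply: eq_integral => r _; rewrite gee0_abs ?lee_fin.
have mq : measurable_fun setT (fun r : R => (2 * (fun r => (r `^ a)^-1) \_ `]0, 1[ (1 - r))%:E).
  apply/measurable_EFinP/measurable_funM => //.
  by apply: (measurableT_comp (mp a)); exact: measurable_funB.
have mq' : measurable_fun setT (fun r : R => (2 * (fun r => (r `^ b)^-1) \_ `]0, 1[ r)%:E).
  by apply/measurable_EFinP/measurable_funM => //; exact: mp.
apply: (@le_lt_trans _ _ (\int[mu]_r ((2 * (fun r => (r `^ b)^-1) \_ `]0%R, 1%R[ r)%:E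
                   + (2 * (fun r => (r `^ a)^-1) \_ `]0%R, 1%R[ (1 - r))%:E))%E).
  apply: ge0_le_integral => //.
  - by move=> r _; rewrite lee_fin kern2_ge0.
  - by apply/measurable_EFinP; exact: measurable_kern2.
  - exact: emeasurable_funD.
  - by move=> r _; rewrite -EFinD lee_fin kern2_1_le.
rewrite ge0_integralD//; first last.
- by move=> r _; rewrite lee_fin mulr_ge0.
- by move=> r _; rewrite lee_fin mulr_ge0.
have i2 (h : R -> R) : measurable_fun setT h -> (forall x, 0 <= h x) ->
    (\int[mu]_r (h r)%:E < +oo -> \int[mu]_r (2 * h r)%:E < +oo)%E.
  move=> mh h0 ih; under eq_integral do rewrite EFinM.
  rewrite ge0_integralZl// ?lte_mul_pinfty//; first exact/measurable_EFinP.
  by move=> x _; rewrite lee_fin.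
rewrite lte_add_pinfty//; first by apply: (i2 ((fun r => (r `^ b)^-1) \_ `]0, 1[)) => //; exact: ip.
apply: (i2 (fun r => (fun r => (r `^ a)^-1) \_ `]0, 1[ (1 - r))) => //.
  by apply: (measurableT_comp (mp a)); exact: measurable_funB.
have := ip a a01; rewrite (@ge0_integral_affine _ (-1) 1).
- rewrite normrN1 mul1e; apply: le_lt_trans; rewrite le_eqVlt; apply/orP; left; apply/eqP.
  by apply: eq_integral => r _; congr (_ _)%:E; ring.
- by rewrite oppr_eq0 oner_eq0.
- exact/measurable_EFinP.
- by move=> r; rewrite lee_fin.
Qed.

(** With nonnegative exponents both kernels are at least 1 on the unit interval, so the integral
    dominates its length. *)
Lemma ebeta1_gt0 a b : 0 <= a < 1 -> 0 <= b < 1 -> (0 < ebeta a b 1)%E.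
Proof.
move=> /andP[a0 a1] /andP[b0 b1].
apply: (@lt_le_trans _ _ (\int[mu]_(r in `]0%R, 1%R[) 1)%E).
  by rewrite integral_cst//= mul1e lebesgue_measure_itv/= lte_fin ltr01 sube0 lte_fin.
rewrite integral_mkcond; apply: ge0_le_integral => //.
- by move=> r _; rewrite patchE; case: ifP.
- by apply/(measurable_restrictT _ _).1.
- by apply/measurable_EFinP; exact: measurable_kern2.
move=> r _; rewrite patchE; case: ifPn => [|_]; last by rewrite lee_fin kern2_ge0.
rewrite inE/= in_itv/= => /andP[r0 r1]; rewrite lee_fin /kern2 !kernE ?subr_gt0//.
have k1 c x : 0 <= c -> 0 < x < 1 -> 1 <= (x `^ c)^-1.
  move=> c0 /andP[x0 x1]; rewrite -[leLHS]invr1 lef_pV2 ?posrE ?powR_gt0//.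
  by rewrite -(powRr0 x) ger_powR// x0 ltW.
by rewrite -[leLHS]mulr1 ler_pM// k1//; apply/andP; split; lra.
Qed.

(* Euler's beta function at (1 - a, 1 - b). *)
Definition Beta a b : R := fine (ebeta a b 1).

Lemma BetaC a b : Beta a b = Beta b a.
Proof. by rewrite /Beta ebetaC. Qed.

Lemma Beta_gt0 a b : 0 <= a < 1 -> 0 <= b < 1 -> 0 < Beta a b.
Proof. by move=> a01 b01; rewrite fine_gt0// ebeta1_gt0// ebeta1_lty. Qed.

Lemma ebetaE a b tau : 0 <= a < 1 -> 0 <= b < 1 -> 0 < tau ->
  ebeta a b tau = (Beta a b * tau `^ (1 - a - b))%:E.
Proof.
move=> a01 b01 tau0; rewrite ebeta_scale// mulrC EFinM /Beta fineK//.
by rewrite ge0_fin_numE ?ebeta1_lty// ltW// ebeta1_gt0.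
Qed.

End kernels.

(** * Fubini's theorem for real-valued integrals *)

Section fubini.
Context {R : realType}.
Local Notation mu := (@lebesgue_measure R).
Local Notation mu2 := ((@lebesgue_measure R) \x (@lebesgue_measure R))%E.

Lemma integrable_fine (F : R -> \bar R) : mu.-integrable setT F ->
  mu.-integrable setT (EFin \o (fine \o F)).
Proof.
move=> iF; have /integrableP[mF _] := iF.
apply: le_integrable iF => //.
  by apply/measurable_EFinP; exact: (measurableT_comp (fine_measurable _)).
by move=> x _ /=; case: (F x) => [r| |] /=; rewrite ?normr0 ?leey ?lexx.
Qed.

(** Integrable functions are finite almost everywhere, so the real-valued inner integrals of
    Fubini's theorem differ from the extended ones on a null set only. *)
Lemma integral_fine (F : R -> \bar R) : mu.-integrable setT F ->
  (\int[mu]_x (fine (F x))%:E = \int[mu]_x F x)%E.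
Proof.
move=> iF; have /integrableP[mF _] := iF.
have /integrableP[mfF _] := integrable_fine iF.
apply: ae_eq_integral => //.
by apply: filterS (integrable_ae measurableT iF) => x + _ => /(_ I) /fineK.
Qed.

Lemma Rintegral_Fubini (G : R * R -> R) : mu2.-integrable setT (EFin \o G) ->
  [/\ mu.-integrable setT (EFin \o (fun x => \int[mu]_y G (x, y))),
      mu.-integrable setT (EFin \o (fun y => \int[mu]_x G (x, y))) &
      \int[mu]_x \int[mu]_y G (x, y) = \int[mu]_y \int[mu]_x G (x, y)].
Proof.
move=> iG.
have i1 := integrable_fubini_F iG.
have i2 : mu.-integrable setT (fun y => \int[mu]_x (G (x, y))%:E)%E.
  have /integrableP[mG _] := iG.
  apply/integrableP; split; first exact: (measurable_fubini_G iG).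
  apply: le_lt_trans ((integrable21ltyP _ _ mG).1 iG).
  apply: ge0_le_integral => //.
  - by apply: measurableT_comp => //; exact: (measurable_fubini_G iG).
  - apply: (measurable_fun_fubini_tonelli_G (m1 := mu) (abse \o (EFin \o G))).
      by apply: measurableT_comp.
    by move=> p /=; rewrite lee_fin.
  - move=> y _; apply: le_abse_integral => //.
    exact: (measurableT_comp mG (measurable_pair2 y)).
split; [exact: integrable_fine i1|exact: integrable_fine i2|].
congr fine; rewrite /Rintegral (integral_fine i1) (integral_fine i2).
exact: (Fubini iG).
Qed.

(* As f need not be integrable, this also covers the times t at which a convolution
   diverges, so that no exceptional null set occurs in the composition of kernels. *)
Lemma RintegralZl_ge0 (k : R) (f : R -> R) : measurable_fun setT f -> 0 <= k ->
  \int[mu]_x (k * f x) = k * \int[mu]_x f x.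
Proof.
move=> mf k0; have mEf : measurable_fun setT (EFin \o f) by exact/measurable_EFinP.
have [->|kneq0] := eqVneq k 0.
  rewrite mul0r; under eq_Rintegral do rewrite mul0r.
  by rewrite Rintegral_cst// mul0r.
have {kneq0}k0 : 0 < k by rewrite lt_neqAle eq_sym kneq0.
rewrite /Rintegral integralE [in RHS]integralE.
rewrite (_ : (fun x => (k * f x)%:E) = (fun x => k%:E * (EFin \o f) x)%E)//.
rewrite (_ : (fun x => (f x)%:E) = EFin \o f)//.
rewrite !(ge0_funeposM _ (ltW k0)) !(ge0_funenegM _ (ltW k0)).
rewrite !ge0_integralZl ?lee_fin ?ltW//; [|exact: measurable_funeneg|exact: measurable_funepos].
have : (0 <= \int[mu]_x ((EFin \o f)^\+ x))%E by exact: integral_ge0.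
have : (0 <= \int[mu]_x ((EFin \o f)^\- x))%E by exact: integral_ge0.
(* If the positive or the negative part has infinite integral, then both sides are 0, since [fine]
   sends infinite values to 0 and k > 0 preserves them. *)
case: (\int[mu]_x ((EFin \o f)^\- x))%E => [q| |]//;
  case: (\int[mu]_x ((EFin \o f)^\+ x))%E => [p| |]//= _ _.
- by rewrite mulrBr.
- by rewrite gt0_muley ?lte_fin//= mulr0.
- by rewrite gt0_muley ?lte_fin//= mulr0.
- by rewrite gt0_muley ?lte_fin//= mulr0.
Qed.

End fubini.

(** * Convolutions with power kernels and their composition *)

Section convolution.
Context {R : realType}.
Local Notation mu := (@lebesgue_measure R).
Local Notation mu2 := ((@lebesgue_measure R) \x (@lebesgue_measure R))%E.
Implicit Types (a b s t r T tau : R) (g : R -> R).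

(* Gamma (1 - b) times the Riemann-Liouville integral of order 1 - b. *)
Definition conv b g t : R := \int[mu]_(s in `]0, t[) (g s / (t - s) `^ b).

Section conv_conv.
Variables (a b T : R) (g : R -> R).
Hypotheses (a01 : 0 <= a < 1) (b01 : 0 <= b < 1) (ab1 : a + b <= 1).
Hypothesis ig : mu.-integrable `]0, T[ (EFin \o g).

(** The zero extensions of g and of the kernels encode the triangle 0 < s < t < T, so that Fubini's
    theorem applies on the whole plane. *)
Let gT := g \_ `]0, T[.
Let G (p : R * R) := kern a (T - p.1) * (kern b (p.1 - p.2) * gT p.2).

Let igT : mu.-integrable setT (EFin \o gT).
Proof. by have := ig; rewrite integrable_mkcond//= restrict_EFin. Qed.

Let mgT : measurable_fun setT gT.
Proof. by have /integrableP[/measurable_EFinP] := igT. Qed.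

Let mG : measurable_fun setT G.
Proof.
apply: measurable_funM.
  apply: (measurableT_comp (measurable_kern a)).
  by apply: measurable_funB => //; exact: measurable_fst.
apply: measurable_funM.
  apply: (measurableT_comp (measurable_kern b)).
  by apply: measurable_funB.
by apply: (measurableT_comp mgT); exact: measurable_snd.
Qed.

Let kkE t s : kern a (T - t) * (kern b (t - s) * gT s) = kern a (T - t) * kern b (t - s) * gT s.
Proof. by rewrite mulrA. Qed.

Let mkk s : measurable_fun setT (fun t => kern a (T - t) * kern b (t - s)).
Proof.
apply: measurable_funM.
  by apply: (measurableT_comp (measurable_kern a)); exact: measurable_funB.
by apply: (measurableT_comp (measurable_kern b)); exact: measurable_funB.
Qed.

(** Integrating in t first leaves |g s| times a multiple of (T - s)^(1-a-b). Since a + b is at most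
    1 this factor is bounded by its value at s = 0, and integrability of g suffices. *)
Let iG : mu2.-integrable setT (EFin \o G).
Proof.
apply/integrable21ltyP; first exact/measurable_EFinP.
have theta0 : 0 <= 1 - a - b by move: ab1; lra.
have B0 := ltW (Beta_gt0 a01 b01).
have k0 : 0 <= Beta a b * T `^ (1 - a - b) by rewrite mulr_ge0 ?powR_ge0.
apply: (@le_lt_trans _ _ (\int[mu]_s ((Beta a b * T `^ (1 - a - b))%:E * `|(gT s)%:E|))%E).
  apply: ge0_le_integral => //.
  - by move=> s _; exact: integral_ge0.
  - apply: (measurable_fun_fubini_tonelli_G (m1 := mu) (abse \o (EFin \o G))).
      by apply: measurableT_comp => //; exact/measurable_EFinP.
    by move=> p /=; rewrite lee_fin.
  - apply: measurable_funeM; apply: measurableT_comp => //.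
    exact/measurable_EFinP.
  move=> s _.
  under eq_integral => t _.
    rewrite /= /G/= kkE normrM EFinM (ger0_norm (mulr_ge0 (kern_ge0 _ _) (kern_ge0 _ _))).
    over.
  rewrite ge0_integralZr//; last 2 first.
    by apply/measurable_EFinP; exact: mkk.
    by move=> t _; rewrite lee_fin mulr_ge0 ?kern_ge0.
  rewrite ebeta_shift /= /gT patchE.
  case: ifPn => [|_]; last by rewrite normr0 !mule0.
  rewrite inE/= in_itv/= => /andP[s0 sT].
  rewrite ebetaE ?subr_gt0// lee_wpmul2r// lee_fin ler_wpM2l// ge0_ler_powR// ?nnegrE; lra.
rewrite ge0_integralZl//; last first.
  by apply: measurableT_comp => //; exact/measurable_EFinP.
by rewrite lte_mul_pinfty//; have /integrableP[] := igT.
Qed.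

Let GE1 t : \int[mu]_s G (t, s) = (fun t => conv b g t / (T - t) `^ a) \_ `]0, T[ t.
Proof.
rewrite /G/= RintegralZl_ge0 ?kern_ge0//; last first.
  apply: measurable_funM => //.
  by apply: (measurableT_comp (measurable_kern b)); exact: measurable_funB.
rewrite patchE; case: ifPn => [|].
  rewrite inE/= in_itv/= => /andP[t0 tT].
  rewrite kernE ?subr_gt0// mulrC; congr (_ / _).
  rewrite /conv Rintegral_mkcond; apply: eq_Rintegral => s _.
  rewrite /gT !patchE; case: ifPn => [|]; rewrite ?inE ?notin_setE/= in_itv/=.
    move=> /andP[s0 sT]; case: ifPn => [|]; rewrite ?inE ?notin_setE/= in_itv/= s0/=.
      by move=> st; rewrite kernE ?subr_gt0// mulrC.
    by move=> /negP; rewrite -leNgt => ts; rewrite kern_le0 ?mul0r// subr_le0.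
  move=> h; rewrite mulr0 ifF//; apply/negP; rewrite inE/= in_itv/= => /andP[s0 st].
  by apply: h; rewrite s0 (lt_trans st).
rewrite notin_setE/= in_itv/= => /negP; rewrite negb_and -!leNgt => /orP[t0|tT].
  rewrite (@eq_Rintegral _ _ _ _ setT (cst 0)) ?Rintegral_cst ?mul0r ?mulr0//.
  move=> s _ /=; rewrite /gT patchE; case: ifPn; rewrite ?mulr0// inE/= in_itv/=.
  by move=> /andP[s0 _]; rewrite kern_le0 ?mul0r//; lra.
by rewrite kern_le0 ?mul0r// subr_le0.
Qed.

Let GE2 s : \int[mu]_t G (t, s) =
  (fun s => Beta a b * ((T - s) `^ (1 - a - b) * g s)) \_ `]0, T[ s.
Proof.
rewrite /G/=; under eq_Rintegral do rewrite kkE mulrC.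
rewrite patchE /gT patchE; case: ifPn => [|_]; last first.
  by under eq_Rintegral do rewrite mul0r; rewrite Rintegral_cst// mul0r.
rewrite inE/= in_itv/= => /andP[s0 sT].
have ikk : mu.-integrable setT (EFin \o (fun t => kern a (T - t) * kern b (t - s))).
  apply/integrableP; split; first by apply/measurable_EFinP; exact: mkk.
  under eq_integral => t _.
    rewrite /= (ger0_norm (mulr_ge0 (kern_ge0 _ _) (kern_ge0 _ _))).
    over.
  by rewrite ebeta_shift ebetaE ?subr_gt0// ltry.
rewrite RintegralZl// /Rintegral ebeta_shift ebetaE ?subr_gt0//=; ring.
Qed.

Lemma integrable_conv_conv :
  mu.-integrable `]0, T[ (EFin \o (fun t => conv b g t / (T - t) `^ a)).
Proof.
have [i1 _ _] := Rintegral_Fubini iG.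
rewrite integrable_mkcond//= restrict_EFin.
by apply: eq_integrable i1 => // t _ /=; rewrite GE1.
Qed.

(** The semigroup law of Riemann-Liouville integrals, without the normalizing Gamma factors. For a +
    b = 1 the composed kernel is constant and the plain integral of g remains. *)
Lemma conv_conv :
  conv a (conv b g) T =
  Beta a b * \int[mu]_(s in `]0, T[) ((T - s) `^ (1 - a - b) * g s).
Proof.
have [_ i2 fub] := Rintegral_Fubini iG.
have -> : conv a (conv b g) T = \int[mu]_t \int[mu]_s G (t, s).
  by rewrite /conv Rintegral_mkcond; apply: eq_Rintegral => t _; rewrite GE1.
rewrite fub; under eq_Rintegral do rewrite GE2.
rewrite -Rintegral_mkcond.
have B0 := Beta_gt0 a01 b01.
rewrite RintegralZl//.
have : mu.-integrable `]0, T[ (EFin \o (fun s => Beta a b * ((T - s) `^ (1 - a - b) * g s))).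
  rewrite integrable_mkcond//= restrict_EFin.
  by apply: eq_integrable i2 => // t _ /=; rewrite GE2.
move=> /(@integrableZl _ _ _ mu _ (measurable_itv `]0, T[) (Beta a b)^-1) h.
apply: eq_integrable h => // s _ /=.
by rewrite -EFinM mulKf// gt_eqF.
Qed.

End conv_conv.
End convolution.

(** * Functions continuous up to time 0 whose derivative is integrable there *)

Section regular_functions.
Context {R : realType}.
Local Notation mu := (@lebesgue_measure R).
Implicit Types (a b s t r T tau theta : R) (f df g h : R -> R).

Lemma within_continuous_bounded f a b : a <= b ->
  {within `[a, b], continuous f} ->
  exists M, forall x, x \in `[a, b] -> `|f x| <= M.
Proof.
move=> ab cf.
have cnf : {within `[a, b], continuous (fun x => `|f x|)}.
  by move=> x; apply: continuous_comp; [exact: cf|exact: norm_continuous].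
by have [c _ fc] := EVT_max ab cnf; exists `|f c|.
Qed.

Lemma integrable_boundedM (D : set R) g h M : measurable D ->
  measurable_fun D h -> (forall x, D x -> `|h x| <= M) ->
  mu.-integrable D (EFin \o g) -> mu.-integrable D (EFin \o (fun x => h x * g x)).
Proof.
move=> mD mh hM ig.
have -> : EFin \o (fun x => h x * g x) = ((EFin \o h) \* (EFin \o g))%E.
  by apply/funext => x /=; rewrite EFinM.
apply: (@integrableMr _ _ _ mu D mD h (EFin \o g) mh _ ig).
exists M; split; first exact: num_real.
by move=> N MN x Dx /=; apply: le_trans (hM x Dx) (ltW MN).
Qed.

Lemma measurable_powRV_rev b t :
  measurable_fun setT (fun s : R => ((t - s) `^ b)^-1).
Proof. by apply: (measurableT_comp (measurable_powRV b)); exact: measurable_funB. Qed.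

Lemma integrable_powRV_rev b t : b < 1 ->
  mu.-integrable `]0, t[ (EFin \o (fun s => ((t - s) `^ b)^-1)).
Proof.
move=> b1.
have /integrableP[mk ik] :
    mu.-integrable setT (EFin \o ((fun r => (r `^ b)^-1) \_ `]0, t[)).
  by have := integrable_powRV t b1; rewrite integrable_mkcond//= restrict_EFin.
rewrite integrable_mkcond//= restrict_EFin.
have mk' : measurable_fun setT ((fun s => ((t - s) `^ b)^-1) \_ `]0, t[).
  by apply/(measurable_restrictT _ _).1 => //; apply: measurable_funTS; exact: measurable_powRV_rev.
apply/integrableP; split; first exact/measurable_EFinP.
rewrite (@ge0_integral_affine _ (-1) t); first last.
- by [].
- by apply: measurableT_comp => //; exact/measurable_EFinP.
- by rewrite oppr_eq0 oner_eq0.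
rewrite normrN1 mul1e; apply: le_lt_trans ik; rewrite le_eqVlt; apply/orP; left; apply/eqP.
apply: eq_integral => s _ /=; congr EFin; congr (`|_|).
rewrite !patchE; have -> : t - (-1 * s + t) = s by ring.
congr (if _ then _ else _).
by apply/idP/idP; rewrite !inE/= !in_itv/= => /andP[? ?]; apply/andP; split; lra.
Qed.

(** Cut at t / 2: on the left g is only integrable but the kernel is bounded, on the right the
    kernel is singular but g is bounded by continuity. *)
Lemma integrable_conv g b t : 0 <= b < 1 -> 0 < t ->
  mu.-integrable `]0, t[ (EFin \o g) ->
  (forall s, 0 < s -> {for s, continuous g}) ->
  mu.-integrable `]0, t[ (EFin \o (fun s => g s / (t - s) `^ b)).
Proof.
move=> /andP[b0 b1] t0 ig cg.
have [||M gM] := @within_continuous_bounded g (t / 2) t; first by lra.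
  apply: continuous_in_subspaceT => x; rewrite inE/= in_itv/= => /andP[tx _].
  by apply: cg; lra.
have M0 : 0 <= M by apply: le_trans (gM t _); rewrite // in_itv/=; lra.
have /integrableP[/measurable_EFinP mg _] := ig.
apply: (@le_integrable _ _ _ mu _ _ _
  (EFin \o (fun s => ((t / 2) `^ b)^-1 * `|g s| + M * ((t - s) `^ b)^-1))) => //.
- apply/measurable_EFinP; apply: measurable_funM => //.
  by apply: measurable_funTS; exact: measurable_powRV_rev.
- move=> s /=; rewrite in_itv/= => /andP[s0 st]; rewrite lee_fin.
  have p0 x : 0 <= (x `^ b)^-1 by rewrite invr_ge0 powR_ge0.
  rewrite [leRHS]ger0_norm; last by rewrite addr_ge0 ?mulr_ge0.
  rewrite normrM (ger0_norm (p0 _)).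
  have [st2|st2] := leP s (t / 2).
    rewrite -[leLHS]addr0 lerD ?mulr_ge0// mulrC ler_wpM2r//.
    rewrite lef_pV2 ?posrE ?powR_gt0//; try lra.
    by rewrite ge0_ler_powR ?nnegrE//; lra.
  rewrite -[leLHS]add0r lerD ?mulr_ge0// ler_wpM2r// gM// in_itv/=; lra.
- rewrite (_ : EFin \o _ = (fun s => ((t / 2) `^ b)^-1%:E * `|(EFin \o g) s|)%E
     \+ (fun s => M%:E * ((t - s) `^ b)^-1%:E)%E); last first.
    by apply/funext => s /=; rewrite EFinD !EFinM.
  apply: integrableD => //; apply: integrableZl => //; last exact: integrable_powRV_rev.
  exact: integrable_abse ig.
Qed.

(** The time regularity of a solution at a fixed point of space: the derivative may be unbounded at
    0, as that of t^gamma is. *)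
Record absC1 f df : Prop := AbsC1 {
  absC1_cont : {within `[0, +oo[, continuous f};
  absC1_derive : forall t, 0 < t -> is_derive t 1 f (df t);
  absC1_dcont : forall t, 0 < t -> {for t, continuous df};
  absC1_int : forall T, 0 < T -> mu.-integrable `]0, T[ (EFin \o df) }.

Section absC1.
Variables (f df : R -> R).
Hypothesis fdf : absC1 f df.

Lemma absC1_itv T : {within `[0, T], continuous f}.
Proof. by apply: continuous_subspaceW (absC1_cont fdf); apply: subset_itvl. Qed.

Lemma absC1_at t : 0 < t -> {for t, continuous f}.
Proof.
move=> /(absC1_derive fdf)[+ _] => /derivable1_diffP; exact: differentiable_continuous.
Qed.

Lemma absC1_measurable T : measurable_fun `]0, T[ f.
Proof.
apply: open_continuous_measurable_fun => // x; rewrite inE/= in_itv/= => /andP[x0 _].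
exact: absC1_at.
Qed.

Lemma absC1_bounded T : 0 <= T -> exists M, forall x, x \in `[0, T] -> `|f x| <= M.
Proof. by move=> T0; apply: within_continuous_bounded => //; exact: absC1_itv. Qed.

Lemma absC1M_int g T : 0 < T -> mu.-integrable `]0, T[ (EFin \o g) ->
  mu.-integrable `]0, T[ (EFin \o (fun t => f t * g t)).
Proof.
move=> T0; have [M fM] := absC1_bounded (ltW T0).
apply: (@integrable_boundedM _ g f M) => //; first exact: absC1_measurable.
by move=> x Dx; apply: fM; exact: subset_itv_oo_cc.
Qed.

Lemma absC1_sqr : absC1 (fun t => f t ^+ 2) (fun t => 2 * (f t * df t)).
Proof.
split.
- move=> x; rewrite (_ : (fun t => f t ^+ 2) = f \* f); last first.
    by apply/funext => t; rewrite expr2.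
  by apply: continuousM; exact: (absC1_cont fdf).
- move=> t t0; have dft := absC1_derive fdf t0.
  by apply: is_derive_eq; rewrite /GRing.scale/=; ring.
- move=> t t0; apply: continuousM; first exact: cst_continuous.
  by apply: continuousM; [exact: absC1_at|exact: (absC1_dcont fdf)].
- move=> T T0.
  have h := @integrableZl _ _ _ mu _ (measurable_itv `]0, T[) 2 _
    (absC1M_int T0 (absC1_int fdf T0)).
  by apply: eq_integrable h => // s _ /=; rewrite -EFinM.
Qed.

End absC1.
End regular_functions.

(** * Energy inequalities *)

Section fractional_inequalities.
Context {R : realType}.
Local Notation mu := (@lebesgue_measure R).
Implicit Types (a b s t r T tau theta : R) (f df g h : R -> R).

Lemma is_derive_powR_rev theta t s : s < t ->
  is_derive s 1 (fun s => (t - s) `^ theta) (- (theta * (t - s) `^ (theta - 1))).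
Proof.
move=> st; have ts0 : 0 < t - s by rewrite subr_gt0.
have dp : is_derive (t - s) 1 (fun r : R => r `^ theta) (theta * (t - s) `^ (theta - 1)).
  exact: is_derive1_powR.
have dl : is_derive s 1 (fun s => t - s) (-1).
  by apply: is_derive_eq; ring.
have := @is_derive1_comp _ (fun r : R => r `^ theta) (fun s => t - s) s _ _ dp dl.
by rewrite mulrN1.
Qed.

Lemma continuous_powR_rev theta t s : s < t ->
  {for s, continuous (fun s => (t - s) `^ theta)}.
Proof.
by move=> /(is_derive_powR_rev theta)[+ _] => /derivable1_diffP /differentiable_continuous.
Qed.

Lemma continuous_powRV_rev b t s : s < t ->
  {for s, continuous (fun s => ((t - s) `^ b)^-1)}.
Proof.
move=> st; rewrite (_ : (fun s => _) = (fun s => (t - s) `^ (- b))).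
  exact: continuous_powR_rev.
by apply/funext => x; rewrite powRN.
Qed.

Section absC1.
Variables (f df : R -> R).
Hypothesis fdf : absC1 f df.

(** Makes (f t - f s)^2 beat the singular kernel at s = t. The estimate stops at t / 2 because df
    may blow up at 0. *)
Lemma absC1_lipschitz_left t : 0 < t ->
  exists2 M, 0 <= M & forall s, t / 2 <= s <= t -> `|f t - f s| <= M * (t - s).
Proof.
move=> t0; have [||M dfM] := @within_continuous_bounded R df (t / 2) t; first by lra.
  apply: continuous_in_subspaceT => x; rewrite inE/= in_itv/= => /andP[tx _].
  by apply: (absC1_dcont fdf); lra.
have M0 : 0 <= M by apply: le_trans (dfM t _); rewrite // in_itv/=; lra.
exists M => // s /andP[ts st].
have [||c cst ->] := @MVT_segment R f df s t st.
- move=> x; rewrite in_itv/= => /andP[sx xt]; apply: (absC1_derive fdf); lra.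
- apply: continuous_subspaceW (absC1_itv (T:=t) fdf) => x /=; rewrite !in_itv/= => /andP[? ?]; lra.
rewrite normrM (@ger0_norm _ (t - s)) ?subr_ge0// ler_wpM2r ?subr_ge0// dfM//.
by move: cst; rewrite !in_itv/= => /andP[? ?]; lra.
Qed.

(* Integrating (f t - f s) f'(s) (t - s)^(-b) by parts; F b t t = 0 despite the
   singular factor. *)
Let F b t : R -> R := (fun s => - 2^-1 * (f t - f s)) \* (fun s => f t - f s)
  \* (fun s => (t - s) `^ (- b)).

Let F_continuous b t : 0 <= b < 1 -> 0 < t -> {within `[0, t], continuous (F b t)}.
Proof.
move=> /andP[b0 b1] t0; apply/continuous_within_itvP => //; split.
- move=> s; rewrite in_itv/= => /andP[s0 st].
  have cf : {for s, continuous (fun s => f t - f s)}.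
    by apply: continuousB; [exact: cst_continuous|exact: (absC1_at fdf)].
  apply: continuousM; last exact: continuous_powR_rev.
  by apply: continuousM => //; apply: continuousM => //; exact: cst_continuous.
- have f0 : f x @[x --> 0^'+] --> f 0.
    by have /(continuous_within_itvP _ t0)[] := absC1_itv (T := t) fdf.
  have cf : (f t - f x) @[x --> 0^'+] --> f t - f 0.
    by apply: cvgB => //; exact: cvg_cst.
  apply: cvgM; last by apply: cvg_at_right_filter; exact: continuous_powR_rev.
  by apply: cvgM => //; apply: cvgM => //; exact: cvg_cst.
- have -> : F b t t = 0 by rewrite /F/= subrr !mulr0 mul0r.
  have [M M0 fM] := absC1_lipschitz_left t0.
  have h0 : (M ^+ 2 * (t - s)) @[s --> t^'-] --> 0.
    apply: cvg_at_left_filter; rewrite -[X in _ --> X](mulr0 (M ^+ 2)) -(subrr t).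
    by apply: cvgM; [exact: cvg_cst|apply: cvgB; [exact: cvg_cst|exact: cvg_id]].
  apply: norm_cvg0; apply: (squeeze_cvgr _ (cvg_cst 0) h0).
  near=> s; rewrite normr_ge0/= /F/=.
  have st : s < t by near: s; exact: nbhs_left_lt.
  have ts2 : t / 2 <= s by near: s; apply: nbhs_left_ge; lra.
  (* With t - s at most 1 and 2 - b at least 1, the power (t - s)^(2-b) is at most t - s. *)
  have ts1 : t - 1 <= s by near: s; apply: nbhs_left_ge; lra.
  have ts0 : 0 < t - s by rewrite subr_gt0.
  have p0 := powR_ge0 (t - s) (- b).
  have -> : - 2^-1 * (f t - f s) * (f t - f s) * (t - s) `^ (- b) =
      - (2^-1 * (f t - f s) ^+ 2 * (t - s) `^ (- b)) by ring.
  rewrite normrN ger0_norm; last by apply: mulr_ge0 => //; rewrite mulr_ge0 ?sqr_ge0 ?invr_ge0.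
  have h : (f t - f s) ^+ 2 <= M ^+ 2 * (t - s) ^+ 2.
    rewrite -exprMn -[leLHS]real_normK ?num_real//; apply: lerXn2r.
    - by rewrite nnegrE.
    - by rewrite nnegrE mulr_ge0// ltW.
    - by apply: fM; rewrite ts2 ltW.
  have h2 : (t - s) ^+ 2 * (t - s) `^ (- b) <= t - s.
    rewrite -(powR_mulrn _ (ltW ts0)) -powRD; last by rewrite (gt_eqF ts0) implybT.
    rewrite -[leRHS](powRr1 (ltW ts0)) ger_powR//; first by apply/andP; split; lra.
    by have := b0; have := b1; lra.
  have h3 : (f t - f s) ^+ 2 * (t - s) `^ (- b) <= M ^+ 2 * (t - s).
    apply: (@le_trans _ _ (M ^+ 2 * (t - s) ^+ 2 * (t - s) `^ (- b))).
      by rewrite ler_wpM2r.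
    by rewrite -mulrA; apply: ler_wpM2l; [exact: sqr_ge0|exact: h2].
  by have := mulr_ge0 (sqr_ge0 (f t - f s)) p0; rewrite -mulrA; lra.
Unshelve. all: by end_near. Qed.

(** The right side minus the left is twice the integral of (f t - f s) f'(s) (t-s)^(-b). The
    derivative of [F b t] is this integrand minus a nonnegative term that comes from differentiating
    the kernel, so the integral is at least F(t) - F(0) = (f t - f 0)^2 t^(-b) / 2. The discarded
    term is never integrated. *)
Lemma conv_sqr_le b t : 0 <= b < 1 -> 0 < t ->
  conv b (fun s => 2 * (f s * df s)) t <= 2 * (f t * conv b df t).
Proof.
move=> b01 t0; have /andP[b0 b1] := b01.
have idf : mu.-integrable `]0, t[ (EFin \o (fun s => df s / (t - s) `^ b)).
  exact: (integrable_conv b01 t0 (absC1_int fdf t0) (absC1_dcont fdf)).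
have iffdf : mu.-integrable `]0, t[ (EFin \o (fun s => f s * (df s / (t - s) `^ b))).
  exact: (absC1M_int fdf t0 idf).
have iftdf : mu.-integrable `]0, t[ (EFin \o (fun s => f t * (df s / (t - s) `^ b))).
  have h := @integrableZl _ _ _ mu _ (measurable_itv `]0, t[) (f t) _ idf.
  by apply: eq_integrable h.
have E1 : conv b (fun s => 2 * (f s * df s)) t =
    2 * \int[mu]_(s in `]0, t[) (f s * (df s / (t - s) `^ b)).
  by rewrite -RintegralZl//; apply: eq_Rintegral => s _; ring.
have E2 : f t * conv b df t = \int[mu]_(s in `]0, t[) (f t * (df s / (t - s) `^ b)).
  by rewrite -RintegralZl.
rewrite E1 E2 ler_wpM2l// -subr_ge0 -RintegralB//.
apply: (@le_trans _ _ (F b t t - F b t 0)).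
  have -> : F b t t - F b t 0 = 2^-1 * (f t - f 0) ^+ 2 * (t - 0) `^ (- b).
    by rewrite /F/= subrr; ring.
  by apply: mulr_ge0; rewrite ?powR_ge0// mulr_ge0 ?sqr_ge0 ?invr_ge0.
pose dF s := (f t - f s) * df s * (t - s) `^ (- b)
   - 2^-1 * (f t - f s) ^+ 2 * (b * (t - s) `^ (- b - 1)).
apply: (@FTC_le_Rintegral _ (F b t) dF); first exact: t0.
- have h := @integrableB _ _ _ mu _ (measurable_itv `]0, t[) _ _ iftdf iffdf.
  by apply: eq_integrable h => // s _ /=; rewrite EFinB.
- move=> s; rewrite in_itv/= => /andP[s0 st].
  apply: continuousB; apply: continuousM.
  + exact: cst_continuous.
  + by apply: continuousM; [exact: (absC1_dcont fdf)|exact: continuous_powRV_rev].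
  + exact: (absC1_at fdf).
  + by apply: continuousM; [exact: (absC1_dcont fdf)|exact: continuous_powRV_rev].
- exact: F_continuous.
- move=> s; rewrite in_itv/= => /andP[s0 st].
  have dfs := absC1_derive fdf s0; have dp := is_derive_powR_rev (- b) st.
  by apply: is_derive_eq; rewrite /dF /GRing.scale/=; field.
- move=> s; rewrite in_itv/= => /andP[s0 st].
  have : 0 <= 2^-1 * (f t - f s) ^+ 2 * (b * (t - s) `^ (- b - 1)).
    by apply: mulr_ge0; rewrite mulr_ge0 ?sqr_ge0 ?powR_ge0 ?invr_ge0.
  rewrite /dF powRN; lra.
Qed.

Lemma within_continuous_powR_rev theta T : 0 <= theta -> 0 < T ->
  {within `[0, T], continuous (fun s => (T - s) `^ theta)}.
Proof.
rewrite le_eqVlt => /predU1P[<- _|theta0 T0].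
  (* At s = T the value 0^0 is 1, so the exponent 0 gives a constant; for positive exponents the
     value there is 0. *)
  have -> : (fun s => (T - s) `^ 0) = cst 1 by apply/funext => s; rewrite powRr0.
  by move=> x; exact: cst_continuous.
apply/continuous_within_itvP => //; split.
- by move=> s; rewrite in_itv/= => /andP[_ ?]; exact: continuous_powR_rev.
- by apply: cvg_at_right_filter; exact: continuous_powR_rev.
- rewrite subrr powR0 ?gt_eqF//.
  apply: (@cvg_comp _ _ _ (fun s => T - s) (fun r => r `^ theta) _ (0^'+)); last exact: powR_cvg0.
  move=> P P0; apply/nbhs_left0P; apply: filterS P0 => e /=.
  by have -> : T - (T - e) = e by ring.
Qed.

(** Integration by parts against the weight (T - s)^theta, which is nonincreasing in s: the term
    with its derivative is nonpositive and is dropped. *)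
Lemma weighted_sqr_ge theta T : 0 <= theta -> 0 < T ->
  0 `^ theta * f T ^+ 2 - T `^ theta * f 0 ^+ 2 <=
  \int[mu]_(s in `]0, T[) ((T - s) `^ theta * (2 * (f s * df s))).
Proof.
move=> theta0 T0.
have ff := absC1_sqr fdf.
have cp := within_continuous_powR_rev theta0 T0.
pose G : R -> R := (fun s => (T - s) `^ theta) \* (fun s => f s ^+ 2).
have -> : 0 `^ theta * f T ^+ 2 - T `^ theta * f 0 ^+ 2 = G T - G 0.
  by rewrite /G/= subrr subr0.
pose dG s := - (theta * (T - s) `^ (theta - 1)) * f s ^+ 2
  + (T - s) `^ theta * (2 * (f s * df s)).
apply: (@FTC_le_Rintegral _ G dG); first exact: T0.
- have [|M pM] := within_continuous_bounded _ cp; first exact: ltW.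
  apply: (@integrable_boundedM _ _ _ _ M) => //; last exact: (absC1_int ff).
  + apply: open_continuous_measurable_fun => // x; rewrite inE/= in_itv/= => /andP[x0 xT].
    exact: continuous_powR_rev.
  + by move=> x Dx; apply: pM; exact: subset_itv_oo_cc.
- move=> s; rewrite in_itv/= => /andP[s0 sT].
  by apply: continuousM; [exact: continuous_powR_rev|exact: (absC1_dcont ff)].
- by move=> x; apply: continuousM; [exact: cp|exact: (absC1_itv ff)].
- move=> s; rewrite in_itv/= => /andP[s0 sT].
  have dfs := absC1_derive ff s0; have dp := is_derive_powR_rev theta sT.
  apply: is_derive_eq; rewrite /dG /GRing.scale/=; ring.
- move=> s _; rewrite /dG gerDr mulNr oppr_le0; apply: mulr_ge0;
    by rewrite ?sqr_ge0// mulr_ge0 ?powR_ge0.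
Qed.

(* As 0 `^ 0 = 1, for b = c the left-hand side is a multiple of f T ^+ 2 - f 0 ^+ 2,
   while for b < c the term in f T vanishes. *)
Lemma conv_energy_ge b c T : 0 < c < 1 -> 0 <= b <= c -> 0 < T ->
  2^-1 * (Beta (1 - c) b * (0 `^ (c - b) * f T ^+ 2 - T `^ (c - b) * f 0 ^+ 2)) <=
  conv (1 - c) (fun t => f t * conv b df t) T.
Proof.
move=> /andP[c0 c1] /andP[b0 bc] T0.
have c01 : 0 <= 1 - c < 1 by apply/andP; split; lra.
have b01 : 0 <= b < 1 by apply/andP; split; lra.
have cb1 : 1 - c + b <= 1 by lra.
have idf := absC1_int fdf T0; have ff := absC1_sqr fdf.
have iff := absC1_int ff T0.
(* The middle term is half the double convolution of the derivative of f^2. Composing its kernels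
   bounds it from below; the pointwise inequality under the outer integral bounds it from above. *)
apply: (@le_trans _ _ (2^-1 * conv (1 - c) (conv b (fun s => 2 * (f s * df s))) T)).
  rewrite ler_wpM2l// conv_conv//; apply: ler_wpM2l; first exact/ltW/Beta_gt0.
  have -> : 1 - (1 - c) - b = c - b by ring.
  by apply: weighted_sqr_ge => //; lra.
have i1 := integrable_conv_conv c01 b01 cb1 iff.
have i2 := absC1M_int fdf T0 (integrable_conv_conv c01 b01 cb1 idf).
rewrite {1}/conv -RintegralZl//; apply: le_Rintegral => //.
- have h := @integrableZl _ _ _ mu _ (measurable_itv `]0, T[) 2^-1 _ i1.
  by apply: eq_integrable h.
- by apply: eq_integrable i2 => // t _ /=; rewrite mulrA.
move=> t /=; rewrite in_itv/= => /andP[t0 tT].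
rewrite mulrA ler_wpM2r ?invr_ge0 ?powR_ge0//.
by have := conv_sqr_le b01 t0; lra.
Qed.

End absC1.
End fractional_inequalities.

(** * Inversion of the Volterra equation *)

Section inversion.
Context {R : realType}.
Local Notation mu := (@lebesgue_measure R).
Implicit Types (a b s t r T c : R) (f df g h y w : R -> R).

Lemma conv0 g t : conv 0 g t = \int[mu]_(s in `]0, t[) g s.
Proof. by apply: eq_Rintegral => s _; rewrite powRr0 divr1. Qed.

Lemma absC1_FTC f df t : absC1 f df -> 0 < t ->
  \int[mu]_(s in `]0, t[) df s = f t - f 0.
Proof.
move=> fdf t0; apply: FTC_Rintegral => //.
- exact: (absC1_int fdf).
- by move=> x; rewrite in_itv/= => /andP[x0 _]; exact: (absC1_dcont fdf).
- exact: (absC1_itv fdf).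
- by move=> x; rewrite in_itv/= => /andP[x0 _]; exact: (absC1_derive fdf).
Qed.

Lemma within_continuous_int y T : {within `[0, +oo[, continuous y} ->
  mu.-integrable `]0, T[ (EFin \o y).
Proof.
move=> cy.
apply: (@integrableS _ _ _ mu `[0, T] `]0, T[ (EFin \o y)) => //.
  exact: subset_itv_oo_cc.
apply: continuous_compact_integrable; first exact: segment_compact.
by apply: continuous_subspaceW cy; exact: subset_itvl.
Qed.

Lemma within_continuous_conv_int w a T : a < 1 -> 0 < T ->
  {within `[0, +oo[, continuous w} ->
  mu.-integrable `]0, T[ (EFin \o (fun t => w t / (T - t) `^ a)).
Proof.
move=> a1 T0 cw.
have cw' : {within `[0, T], continuous w}.
  by apply: continuous_subspaceW cw; exact: subset_itvl.
have [M wM] := within_continuous_bounded (ltW T0) cw'.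
apply: (@integrable_boundedM _ _ _ w M) => //.
- by have /integrableP[/measurable_EFinP] := within_continuous_int T cw.
- by move=> x Dx; apply: wM; exact: subset_itv_oo_cc.
- exact: integrable_powRV_rev.
Qed.

(** By Lebesgue differentiation h is almost everywhere the derivative of its primitive, which
    vanishes in a neighbourhood of each interior point. *)
Lemma Rintegral_eq0_ae h T : mu.-integrable `]0, T[ (EFin \o h) ->
  (forall t, 0 < t < T -> \int[mu]_(s in `]0, t[) h s = 0) ->
  {ae mu, forall t, t \in `]0, T[ -> h t = 0}.
Proof.
move=> ih h0; pose h' := h \_ `]0, T[.
have ih' : mu.-integrable setT (EFin \o h').
  by have := ih; rewrite integrable_mkcond//= restrict_EFin.
have lh' : locally_integrable setT h' by exact: integrable_locally ih.
have ih'S (z : R) : mu.-integrable [set` Interval (BLeft 0) (BRight z)] (EFin \o h').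
  exact: (integrableS measurableT).
have := FTC1 ih'S lh'; apply: filterS; first exact: (ae_filter_ringOfSetsType mu).
move=> x /= + xT.
have /itvP xTP := xT.
have x0 : (0%:E < x%:E)%E by rewrite lte_fin xTP.
move=> /(_ x0)[_].
set P := fun _ => _ => dP.
have P0 z : 0 < z < T -> P z = 0.
  move=> /andP[z0 zT]; rewrite /P Rintegral_itvoo_cc; last first.
    by have /integrableP[/measurable_EFinP + _] := ih'; exact: measurable_funS.
  apply: (etrans _ (h0 z _)); last by rewrite z0.
  apply: eq_Rintegral => s; rewrite inE/= in_itv/= => /andP[s0 sz].
  by rewrite /h' patchE mem_set//= in_itv/= s0 (lt_trans sz).
have : derive1 P x = 0.
  rewrite derive1E (@near_eq_derive _ _ _ _ (cst 0)) ?derive_cst//.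
  near=> z; rewrite P0//=; apply/andP; split; near: z.
    by apply: lt_nbhsr; rewrite xTP.
  by apply: lt_nbhsl; rewrite xTP.
by rewrite dP /h' patchE mem_set.
Unshelve. all: by end_near. Qed.

(* Convolution commutes with integration, so conv gamma df and c B y have the same
   integral over every ]0, t[, hence agree almost everywhere. *)
Lemma conv_inversion f df y c gamma T : 0 < gamma < 1 -> 0 < T -> absC1 f df ->
  {within `[0, +oo[, continuous y} ->
  (forall t, 0 < t -> f t - f 0 = c * conv (1 - gamma) y t) ->
  conv (1 - gamma) (fun t => f t * conv gamma df t) T =
  c * Beta gamma (1 - gamma) * conv (1 - gamma) (fun t => f t * y t) T.
Proof.
move=> /andP[g0 g1] T0 fdf cy fE.
have g01 : 0 <= gamma < 1 by rewrite ltW.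
have g01' : 0 <= 1 - gamma < 1 by apply/andP; split; lra.
have z01 : 0 <= (0 : R) < 1 by rewrite lexx ltr01.
have gz : gamma + 0 <= 1 by lra.
have zg : 0 + gamma <= 1 by lra.
have gg : gamma + (1 - gamma) <= 1 by lra.
have gg' : 1 - gamma + gamma <= 1 by lra.
set B := Beta gamma (1 - gamma).
have iy t := within_continuous_int t cy.
have idf t := absC1_int fdf (T := t).
pose h t := conv gamma df t - c * B * y t.
have icdf t : 0 < t -> mu.-integrable `]0, t[ (EFin \o conv gamma df).
  move=> t0; have := integrable_conv_conv z01 g01 zg (idf _ t0).
  by apply: eq_integrable => // s _ /=; rewrite powRr0 divr1.
have iBy t : mu.-integrable `]0, t[ (EFin \o (fun s => c * B * y s)).
  have := @integrableZl _ _ _ mu _ (measurable_itv `]0, t[) (c * B) _ (iy t).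
  by apply: eq_integrable.
have ih t : 0 < t -> mu.-integrable `]0, t[ (EFin \o h).
  move=> t0; have := @integrableB _ _ _ mu _ (measurable_itv `]0, t[) _ _ (icdf t t0) (iBy t).
  by apply: eq_integrable => // s _ /=; rewrite EFinB.
have h0 t : 0 < t < T -> \int[mu]_(s in `]0, t[) h s = 0.
  move=> /andP[t0 _]; rewrite /h RintegralB//; last exact: icdf.
  rewrite RintegralZl// -conv0 (conv_conv z01 g01 zg (idf _ t0)).
  (* Exponent 0 makes [conv] plain integration. Both orders of composition have the same kernel, so
     the kernel of exponent gamma may act on the primitive f - f 0, for which the Volterra equation
     is available. *)
  have -> : Beta 0 gamma * (\int[mu]_(s in `]0, t[) ((t - s) `^ (1 - 0 - gamma) * df s)) =
      conv gamma (conv 0 df) t.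
    rewrite (conv_conv g01 z01 gz (idf _ t0)) BetaC; congr (_ * _).
    by apply: eq_Rintegral => s _; congr (_ `^ _ * _); ring.
  have -> : conv gamma (conv 0 df) t = c * conv gamma (conv (1 - gamma) y) t.
    rewrite -RintegralZl//; last exact: (integrable_conv_conv g01 g01' gg (iy t)).
    apply: eq_Rintegral => s; rewrite inE/= in_itv/= => /andP[s0 _].
    by rewrite conv0 (absC1_FTC fdf s0) fE// mulrA.
  rewrite (conv_conv g01 g01' gg (iy t)) mulrA; apply/eqP; rewrite subr_eq0; apply/eqP.
  congr (_ * _); apply: eq_Rintegral => s _.
  by rewrite subrr powRr0 mul1r.
have i1 := absC1M_int fdf T0 (integrable_conv_conv g01' g01 gg' (idf _ T0)).
have i2 : mu.-integrable `]0, T[ (EFin \o (fun t => f t * y t / (T - t) `^ (1 - gamma))).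
  have /andP[_ g1'] := g01'.
  apply: (within_continuous_conv_int g1' T0) => x.
  by apply: continuousM; [exact: (absC1_cont fdf)|exact: cy].
rewrite -RintegralZl//; congr fine.
apply: ae_eq_integral => //.
- have /integrableP[+ _] := i1; apply: eq_measurable_fun => t _ /=.
  by rewrite mulrA.
- have /integrableP[/measurable_EFinP mfy _] := i2.
  by apply/measurable_EFinP; exact: measurable_funM.
(* Equality almost everywhere suffices, as the two functions are compared only under the outer
   integral. *)
have := Rintegral_eq0_ae (ih T T0) h0.
apply: filterS; first exact: (ae_filter_ringOfSetsType mu).
move=> t h0t Tt.
have := h0t Tt; rewrite /h => /eqP; rewrite subr_eq0 => /eqP ->.
by congr EFin; ring.
Qed.

End inversion.

(** * Continuity, measurability and slices in two variables *)

Section product_measurability.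
Context {R : realType}.
Implicit Types (A B : set R).

(** Measurability in the plane refers to the product sigma-algebra; an open set is the countable
    union of the boxes with rational corners that it contains. *)
Lemma open_measurable_prod (U : set (R * R)) : open U -> measurable U.
Proof.
move=> oU.
pose box (a b c d : rat) : set (R * R) :=
  `]ratr a, ratr b[%classic `*` `]ratr c, ratr d[%classic.
pose F a b c d := if `[< box a b c d `<=` U >] then box a b c d else set0.
have -> : U = \bigcup_a \bigcup_b \bigcup_c \bigcup_d F a b c d.
  apply/seteqP; split => [[x y] Uxy|z [a _ [b _ [c _ [d _]]]]]; last first.
    by rewrite /F; case: asboolP => // + ?; exact.
  have /nbhs_ballP[e /= e0 eU] : nbhs (x, y) U by exact: open_nbhs_nbhs.
  have lt1 (z : R) : z - e < z by lra.
  have lt2 (z : R) : z < z + e by lra.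
  have [a xa] := rat_in_itvoo (lt1 x); have [b xb] := rat_in_itvoo (lt2 x).
  have [c yc] := rat_in_itvoo (lt1 y); have [d yd] := rat_in_itvoo (lt2 y).
  move: xa xb yc yd; rewrite !in_itv/= => /andP[? ?] /andP[? ?] /andP[? ?] /andP[? ?].
  exists a => //; exists b => //; exists c => //; exists d => //.
  rewrite /F ifT; first by split; rewrite /= in_itv/=; apply/andP; split.
  apply/asboolP => -[x' y'] [/=]; rewrite !in_itv/= => /andP[? ?] /andP[? ?].
  by apply: eU; split; rewrite /ball/= ltr_norml; apply/andP; split; lra.
apply: bigcupT_measurable_rat => a; apply: bigcupT_measurable_rat => b.
apply: bigcupT_measurable_rat => c; apply: bigcupT_measurable_rat => d.
by rewrite /F; case: asboolP => // _; apply: measurableX; exact: measurable_itv.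
Qed.

Lemma within_continuous_measurable_prod (D : set (R * R)) (w : R * R -> R) :
  measurable D -> {within D, continuous w} -> measurable_fun D w.
Proof.
move=> mD /continuousP cw; apply: (measurability _ (RGenOpens.measurableE R)).
move=> _ [_ [a [b ->] <-]].
have /cw/open_subspaceP[V oV VD] : open (`]a, b[%classic : set R) by exact: interval_open.
by rewrite setIC -VD; apply: measurableI => //; exact: open_measurable_prod.
Qed.

Lemma within_continuous_slice1 A B (w : R -> R -> R) x : A x ->
  {within A `*` B, continuous (fun p => w p.1 p.2)} -> {within B, continuous (w x)}.
Proof.
move=> Ax /subspace_continuousP cw; apply/subspace_continuousP => t Bt P Pw.
have := cw (x, t) (conj Ax Bt) P Pw; rewrite /= /nbhs/= /within/=.
have cx : (x, t') @[t' --> t] --> (x, t).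
  by apply: (@cvg_pair _ _ _ (nbhs t) (nbhs x) (nbhs t)); [exact: cvg_cst|exact: cvg_id].
move=> h; have {}h : \forall t' \near t, (A `*` B) (x, t') -> P (w x t').
  exact: (cx _ h).
by apply: filterS h => t' h Bt'; apply: h; split.
Qed.

Lemma within_continuous_slice2 A B (w : R -> R -> R) t : B t ->
  {within A `*` B, continuous (fun p => w p.1 p.2)} -> {within A, continuous (w ^~ t)}.
Proof.
move=> Bt /subspace_continuousP cw; apply/subspace_continuousP => x Ax P Pw.
have := cw (x, t) (conj Ax Bt) P Pw; rewrite /= /nbhs/= /within/=.
have cx : (x', t) @[x' --> x] --> (x, t).
  by apply: (@cvg_pair _ _ _ (nbhs x) (nbhs x) (nbhs t)); [exact: cvg_id|exact: cvg_cst].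
move=> h; have {}h : \forall x' \near x, (A `*` B) (x', t) -> P (w x' t).
  exact: (cx _ h).
by apply: filterS h => x' h Ax'; apply: h; split.
Qed.

Lemma within_continuous_box_bounded (a b c d : R) (w : R -> R -> R) :
  {within `[a, b] `*` `[c, d], continuous (fun p => w p.1 p.2)} ->
  exists M, forall x y, x \in `[a, b] -> y \in `[c, d] -> `|w x y| <= M.
Proof.
move=> cw; have kab : compact (`[a, b] `*` `[c, d] : set (R * R)).
  by apply: compact_setX; exact: segment_compact.
have := continuous_compact cw kab.
move=> /compact_bounded[M [Mreal wM]]; exists (M + 1) => x y xab ycd.
by apply: (wM (M + 1)); [rewrite ltrDl|exists (x, y)].
Qed.

Lemma is_derive_derivable_within A (f : R -> R) x : nbhs x A ->
  derivable_within A f x -> is_derive x 1 f (derive_within A f x).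
Proof.
move=> nA dA.
have dl : h^-1 *: ((f \o shift x) (h *: (1 : R)) - f x) @[h --> 0^'] --> derive_within A f x.
  move=> P /dA h.
  have {}h : \forall y \near x, y != x -> A y -> P (diff_quot f x y) by exact: h.
  have {}h : \forall y \near x, y != x -> P (diff_quot f x y).
    by apply: filterS2 nA h => y Ay h yx; exact: h.
  move/nbhs_ballP : h => [e /= e0 eP].
  have : \forall k \near (0 : R), k != 0 -> P (k^-1 *: ((f \o shift x) (k *: (1 : R)) - f x)).
    apply/nbhs_ballP; exists e => // k /=; rewrite /ball/= sub0r normrN => ke k0.
    rewrite /GRing.scale/= mulr1 mulrC -[X in _ / X](addrK x).
    apply: eP; last by rewrite -subr_eq0 addrK.
    by rewrite /ball/= opprD addrCA subrr addr0 normrN.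
  by [].
apply: DeriveDef; first by apply/cvg_ex; eexists; exact: dl.
exact: (cvg_lim _ dl).
Qed.

End product_measurability.

(** * Size of convolutions, and their exchange with integration in space *)

Section convolution_bounds.
Context {R : realType}.
Local Notation mu := (@lebesgue_measure R).
Local Notation mu2 := ((@lebesgue_measure R) \x (@lebesgue_measure R))%E.
Implicit Types (a b s t x T : R) (g : R -> R) (w : R -> R -> R).

(** The constant 1 is the kernel of exponent 0, so this is again a beta integral. *)
Lemma conv_cst1 b t : 0 <= b < 1 -> 0 < t ->
  conv b (cst 1) t = Beta b 0 * t `^ (1 - b).
Proof.
move=> b01 t0.
have z01 : 0 <= (0 : R) < 1 by rewrite lexx ltr01.
rewrite -[1 - b]subr0 -[RHS]/(fine (_%:E)) -ebetaE//; congr fine.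
rewrite [LHS]integral_mkcond; apply: eq_integral => s _; rewrite restrict_EFin/=.
congr EFin; rewrite patchE /kern2; case: ifPn => [|]; rewrite ?inE ?notin_setE/= in_itv/=.
  by move=> /andP[s0 st]; rewrite !kernE ?subr_gt0// powRr0 invr1 mulr1 div1r.
move=> /negP; rewrite negb_and -!leNgt => /orP[s0|ts].
  by rewrite [kern 0 s]kern_le0// mulr0.
by rewrite kern_le0 ?mul0r// subr_le0.
Qed.

Lemma conv_norm_le b g t M : 0 <= b < 1 -> 0 < t ->
  mu.-integrable `]0, t[ (EFin \o (fun s => g s / (t - s) `^ b)) ->
  (forall s, s \in `]0, t[ -> `|g s| <= M) ->
  `|conv b g t| <= M * (Beta b 0 * t `^ (1 - b)).
Proof.
move=> b01 t0 ig gM; have /andP[_ b1] := b01.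
apply: (le_trans (le_normr_Rintegral _ ig)) => //.
have ik : mu.-integrable `]0, t[ (EFin \o (fun s => cst 1 s / (t - s) `^ b)).
  by have := integrable_powRV_rev t b1; apply: eq_integrable => // s _ /=; rewrite div1r.
rewrite -conv_cst1// -RintegralZl//; apply: le_Rintegral => //.
- exact: (integrable_abse ig).
- have h := @integrableZl _ _ _ mu _ (measurable_itv `]0, t[) M _ ik.
  by apply: eq_integrable h.
move=> s sI /=; rewrite normrM (@ger0_norm _ (_^-1)) ?invr_ge0 ?powR_ge0// mul1r.
by rewrite ler_wpM2r ?invr_ge0 ?powR_ge0// gM.
Qed.

(** For g bounded near 0 the convolution is O(t^(1-b)). This gives the Volterra equation its initial
    value. *)
Lemma conv_cvg0 b g : 0 <= b < 1 -> {within `[0, +oo[, continuous g} ->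
  conv b g t @[t --> 0^'+] --> 0.
Proof.
move=> b01 cg; have /andP[_ b1] := b01.
have [|M gM] := @within_continuous_bounded R g 0 1 ler01.
  by apply: continuous_subspaceW cg; apply: subset_itvl.
have h0 : (M * (Beta b 0 * t `^ (1 - b))) @[t --> 0^'+] --> 0.
  rewrite -[X in _ --> X](mulr0 M); apply: cvgM; first exact: cvg_cst.
  rewrite -[X in _ --> X](mulr0 (Beta b 0)); apply: cvgM; first exact: cvg_cst.
  by apply: powR_cvg0; rewrite subr_gt0.
apply: norm_cvg0; apply: (squeeze_cvgr _ (cvg_cst 0) h0).
near=> t; rewrite normr_ge0/=.
have t0 : 0 < t by near: t; exact: nbhs_right_gt.
have t1 : t <= 1 by near: t; exact: nbhs_right_le.
apply: conv_norm_le => //; first exact: within_continuous_conv_int.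
move=> s; rewrite in_itv/= => /andP[s0 st]; apply: gM.
by rewrite in_itv/= (ltW s0)/= (le_trans (ltW st)).
Unshelve. all: by end_near. Qed.

Lemma integrable_patch (D : set R) g : measurable D ->
  mu.-integrable setT (EFin \o (g \_ D)) -> mu.-integrable D (EFin \o g).
Proof. by move=> mD ig; rewrite integrable_mkcond//= restrict_EFin. Qed.

Section conv_Fubini.
Variables (a b al T : R) (w : R -> R -> R).
Hypothesis al01 : 0 <= al < 1.
Hypothesis cw : {within `[a, b] `*` `[0, +oo[, continuous (fun p => w p.1 p.2)}.

Let D : set (R * R) := `]a, b[ `*` `]0, T[.
Let W (p : R * R) : R := ((fun p => w p.1 p.2) \_ D) p * kern al (T - p.2).

Let mD : measurable D.
Proof. by apply: measurableX; exact: measurable_itv. Qed.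

Let cwD : {within `[a, b] `*` `[0, T], continuous (fun p => w p.1 p.2)}.
Proof.
by apply: continuous_subspaceW cw; apply: setSX => //; apply: subset_itvl.
Qed.

Let cwDo : {within D, continuous (fun p => w p.1 p.2)}.
Proof.
by apply: continuous_subspaceW cwD; apply: setSX; exact: subset_itv_oo_cc.
Qed.

Let mW : measurable_fun setT W.
Proof.
apply: measurable_funM.
  apply/(measurable_restrictT _ _).1 => //.
  exact: within_continuous_measurable_prod.
apply: (measurableT_comp (measurable_kern al)).
by apply: measurable_funB.
Qed.

(** As w is bounded on the compact box, |W| is dominated by a product: a constant on the space
    interval times the integrable kernel in time. *)
Let iW : mu2.-integrable setT (EFin \o W).
Proof.
have [M wM] := within_continuous_box_bounded cwD.
have /andP[_ al1] := al01.
apply/integrable12ltyP; first exact/measurable_EFinP.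
pose k s : R := ((fun s => ((T - s) `^ al)^-1) \_ `]0, T[) s.
have k0 s : 0 <= k s by rewrite /k patchE; case: ifP => // _; rewrite invr_ge0 powR_ge0.
have ik : mu.-integrable setT (EFin \o k).
  by have := integrable_powRV_rev T al1; rewrite integrable_mkcond//= restrict_EFin.
have mk : measurable_fun setT k by have /integrableP[/measurable_EFinP] := ik.
(* The bound M may be negative if the box is empty, hence the absolute value. *)
pose i x : R := (cst `|M|) \_ `]a, b[ x.
have i0 x : 0 <= i x by rewrite /i patchE; case: ifP.
have mi : measurable_fun setT i.
  by apply/(measurable_restrictT _ _).1.
have Wle x s : `|W (x, s)| <= i x * k s.
  rewrite /W /i /k !patchE.
  have [xI|xI] := boolP (x \in `]a, b[%classic); last first.
    rewrite ifF ?mul0r ?normr0//; apply/negP; rewrite inE => -[/= xI' _].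
    by move: xI; rewrite notin_setE.
  have [sI|sI] := boolP (s \in `]0, T[%classic); last first.
    rewrite ifF ?mul0r ?mulr0 ?normr0//; apply/negP; rewrite inE => -[/= _ sI'].
    by move: sI; rewrite notin_setE.
  move: xI sI; rewrite !inE => xI sI; rewrite mem_set//.
  have sT : 0 < T - s by move: sI; rewrite /= in_itv/= subr_gt0 => /andP[].
  rewrite normrM (ger0_norm (kern_ge0 _ _)) kernE//=.
  rewrite ler_wpM2r ?invr_ge0 ?powR_ge0// (le_trans _ (ler_norm M))// wM//.
    exact: subset_itv_oo_cc xI.
  exact: subset_itv_oo_cc sI.
have kfin : (\int[mu]_s (k s)%:E < +oo)%E.
  have /integrableP[_] := ik; apply: le_lt_trans; rewrite le_eqVlt; apply/orP; left; apply/eqP.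
  by apply: eq_integral => s _; rewrite /= ger0_norm.
have kfin0 : (0 <= \int[mu]_s (k s)%:E)%E.
  by apply: integral_ge0 => s _; rewrite lee_fin.
apply: (@le_lt_trans _ _ (\int[mu]_x ((i x)%:E * \int[mu]_s (k s)%:E))%E).
  apply: ge0_le_integral => //.
  - by move=> x _; exact: integral_ge0.
  - apply: (measurable_fun_fubini_tonelli_F (m2 := mu) (abse \o (EFin \o W))).
      by apply: measurableT_comp => //; exact/measurable_EFinP.
    by move=> p /=; rewrite lee_fin.
  - by apply: emeasurable_funM => //; exact/measurable_EFinP.
  move=> x _; rewrite -ge0_integralZl//; first last.
  - by rewrite lee_fin.
  - by move=> s _; rewrite lee_fin.
  - exact/measurable_EFinP.
  apply: ge0_le_integral => //.
  - apply: measurableT_comp => //; apply/measurable_EFinP.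
    exact: (measurableT_comp mW (measurable_pair1 x)).
  - by apply/measurable_EFinP; apply: measurable_funM.
  by move=> s _; rewrite -EFinM lee_fin.
rewrite ge0_integralZr//; first last.
- by move=> x _; rewrite lee_fin.
- exact/measurable_EFinP.
rewrite lte_mul_pinfty//; first by apply: integral_ge0 => x _; rewrite lee_fin.
  rewrite ge0_fin_numE; last by apply: integral_ge0 => x _; rewrite lee_fin.
  have -> : (\int[mu]_x (i x)%:E = \int[mu]_(x in `]a, b[) `|M|%:E)%E.
    by rewrite [RHS]integral_mkcond; apply: eq_integral => x _; rewrite /i !patchE; case: ifP.
  rewrite integral_cst//= lebesgue_measure_itv/=.
  by case: ifP; rewrite ?mule0 ?ltry// -EFinB -EFinM ltry.
Qed.

Let WE1 x : \int[mu]_t W (x, t) = (fun x => conv al (w x) T) \_ `]a, b[ x.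
Proof.
rewrite patchE; have [xI|xI] := boolP (x \in `]a, b[%classic); last first.
  rewrite (@eq_Rintegral _ _ _ _ setT (cst 0)) ?Rintegral_cst ?mul0r//.
  move=> t _ /=; rewrite /W patchE ifF ?mul0r//; apply/negP; rewrite inE => -[/= xI' _].
  by move: xI; rewrite notin_setE.
rewrite /conv [RHS]Rintegral_mkcond; apply: eq_Rintegral => t _; rewrite /W !patchE.
have [tI|tI] := boolP (t \in `]0, T[%classic); last first.
  rewrite ifF ?mul0r//; apply/negP; rewrite inE => -[/= _ tI'].
  by move: tI; rewrite notin_setE.
move: xI tI; rewrite !inE => xI tI; rewrite mem_set//= kernE//.
by move: tI; rewrite /= in_itv/= subr_gt0 => /andP[].
Qed.

Let WE2 t : \int[mu]_x W (x, t) =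
  (fun t => \int[mu]_(x in `]a, b[) w x t / (T - t) `^ al) \_ `]0, T[ t.
Proof.
rewrite patchE; have [tI|tI] := boolP (t \in `]0, T[%classic); last first.
  rewrite (@eq_Rintegral _ _ _ _ setT (cst 0)) ?Rintegral_cst ?mul0r//.
  move=> x _ /=; rewrite /W patchE ifF ?mul0r//; apply/negP; rewrite inE => -[/= _ tI'].
  by move: tI; rewrite notin_setE.
move: tI; rewrite inE => tI.
have iw : mu.-integrable `]a, b[ (EFin \o (w ^~ t)).
  apply: (@integrableS _ _ _ mu `[a, b] `]a, b[) => //; first exact: subset_itv_oo_cc.
  apply: continuous_compact_integrable; first exact: segment_compact.
  apply: within_continuous_slice2 cwD; exact: subset_itv_oo_cc tI.
rewrite -RintegralZr// [RHS]Rintegral_mkcond; apply: eq_Rintegral => x _; rewrite /W !patchE.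
have [xI|xI] := boolP (x \in `]a, b[%classic); last first.
  rewrite ifF ?mul0r//; apply/negP; rewrite inE => -[/= xI' _].
  by move: xI; rewrite notin_setE.
move: xI; rewrite inE => xI; rewrite mem_set//= kernE//.
by move: tI; rewrite /= in_itv/= subr_gt0 => /andP[].
Qed.

Lemma conv_Fubini :
  [/\ mu.-integrable `]a, b[ (EFin \o (fun x => conv al (w x) T)),
      mu.-integrable `]0, T[
        (EFin \o (fun t => \int[mu]_(x in `]a, b[) w x t / (T - t) `^ al)) &
      \int[mu]_(x in `]a, b[) conv al (w x) T =
      conv al (fun t => \int[mu]_(x in `]a, b[) w x t) T].
Proof.
have [i1 i2 fub] := Rintegral_Fubini iW; split.
- apply: integrable_patch; first exact: measurable_itv.
  apply: eq_integrable i1; first exact: measurableT.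
  by move=> x _; rewrite /comp WE1.
- apply: integrable_patch; first exact: measurable_itv.
  apply: eq_integrable i2; first exact: measurableT.
  by move=> t _; rewrite /comp WE2.
- rewrite Rintegral_mkcond [RHS]Rintegral_mkcond.
  transitivity (\int[mu]_x \int[mu]_t W (x, t)).
    by apply: eq_Rintegral => x _; rewrite WE1.
  by rewrite fub; apply: eq_Rintegral => t _; rewrite WE2.
Qed.

End conv_Fubini.
End convolution_bounds.

Lemma nbhs_itvoo_cc {R : realType} (a b x : R) : x \in `]a, b[ -> nbhs x `[a, b]%classic.
Proof.
move=> xI; apply: (@filterS _ _ _ `]a, b[%classic); first exact: subset_itv_oo_cc.
by apply: open_nbhs_nbhs; split => //; exact: interval_open.
Qed.

(** * The solution *)

Section solution.
Context {R : realType}.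
Local Notation mu := (@lebesgue_measure R).
Variables (gamma kappa lambda xl xr : R) (u : R -> R -> R).
Hypotheses (gamma01 : 0 < gamma < 1) (kappa_gt0 : 0 < kappa).
Hypothesis xl_lt_xr : xl < xr.
Hypothesis u_reg : spacetime_regular xl xr u.
Implicit Types (x t s T : R).

Let v x t := expR (lambda * t) * u x t.
(** Explicit formulas in the derivatives of u, meaningful up to the boundary. They are shown to be
    derivatives of [v] only where this is used: at positive times, and inside the space interval. *)
Let v_t x t := expR (lambda * t) * (dt u x t + lambda * u x t).
Let v_x x t := expR (lambda * t) * dx xl xr u x t.
Let v_xx x t := expR (lambda * t) * dxx xl xr u x t.

Lemma Gamma_ge0 (a : R) : 0 <= Gamma a.
Proof. by apply: Rintegral_ge0 => x _; rewrite mulr_ge0 ?powR_ge0 ?expR_ge0. Qed.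

Lemma continuous_expRM : continuous (fun t => expR (lambda * t)).
Proof.
move=> t; apply: continuous_comp; last exact: continuous_expR.
by apply: continuousM; [exact: cst_continuous|exact: cvg_id].
Qed.

Lemma continuous_expRM_snd : continuous (fun p : R * R => expR (lambda * p.2)).
Proof.
move=> p; apply: (@continuous_comp _ _ _ snd (fun t => expR (lambda * t))).
  exact: cvg_snd.
exact: continuous_expRM.
Qed.

Lemma is_derive_expRM t : is_derive t 1 (fun t => expR (lambda * t)) (lambda * expR (lambda * t)).
Proof.
have dl : is_derive t 1 (fun t => lambda * t) lambda.
  by apply: is_derive_eq; rewrite /GRing.scale/= ; ring.
have := @is_derive1_comp _ expR (fun t => lambda * t) t _ _ (is_derive_expR _) dl.
by rewrite mulrC.
Qed.

Let box_within (D : set (R * R)) (w : R -> R -> R) :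
  {within D, continuous (fun p => w p.1 p.2)} ->
  {within D, continuous (fun p => expR (lambda * p.2) * w p.1 p.2)}.
Proof.
move=> cw; have ce := @continuous_subspaceT _ _ D _ continuous_expRM_snd.
by move=> p; exact: (continuousM (ce p) (cw p)).
Qed.

Lemma v_cont : {within `[xl, xr] `*` `[0, +oo[, continuous (fun p => v p.1 p.2)}.
Proof. exact: box_within (regular_cont u_reg). Qed.

Lemma v_x_cont : {within `[xl, xr] `*` `[0, +oo[, continuous (fun p => v_x p.1 p.2)}.
Proof. exact: box_within (regular_dx_cont u_reg). Qed.

Lemma v_xx_cont : {within `[xl, xr] `*` `[0, +oo[, continuous (fun p => v_xx p.1 p.2)}.
Proof. exact: box_within (regular_dxx_cont u_reg). Qed.

(** Integrability of [v_t] at time 0 comes from the function g that dominates the time derivative of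
    u uniformly in x. *)
Lemma absC1_v x : x \in `[xl, xr] -> absC1 (v x) (v_t x).
Proof.
move=> xI; have Ax : [set` `[xl, xr]] x by [].
have cv := within_continuous_slice1 Ax v_cont.
have cdt : {within `]0, +oo[, continuous (v_t x)}.
  have ce : {within `]0, +oo[, continuous (fun t => expR (lambda * t))}.
    by apply: continuous_subspaceT; exact: continuous_expRM.
  have c1 : {within `]0, +oo[, continuous (dt u x)}.
    exact: (within_continuous_slice1 Ax (regular_dt_cont u_reg)).
  have c2 : {within `]0, +oo[, continuous (u x)}.
    have : {within `[0, +oo[, continuous (u x)}.
      exact: (within_continuous_slice1 Ax (regular_cont u_reg)).
    by apply: continuous_subspaceW; apply: subset_itvr; rewrite bnd_simp.
  move=> t; have c3 := continuousM (@cst_continuous _ _ lambda _) (c2 t).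
  exact: (continuousM (ce t) (continuousD (c1 t) c3)).
have cdt' t : 0 < t -> {for t, continuous (v_t x)}.
  move=> t0; move: cdt; rewrite continuous_open_subspace//.
  by apply; rewrite inE/= in_itv/= t0.
split => //.
- move=> t t0; have dut : is_derive t 1 (u x) (dt u x t).
    by rewrite /dt derive1E; apply/derivableP; exact: (regular_dt u_reg).
  have de := is_derive_expRM t.
  by apply: is_derive_eq; rewrite /v_t /GRing.scale/=; ring.
- move=> T T0; have [g [gi gb]] := regular_dt_bound u_reg.
  have [|M uM] := @within_continuous_bounded R (u x) 0 T (ltW T0).
    have : {within `[0, +oo[, continuous (u x)}.
      exact: (within_continuous_slice1 Ax (regular_cont u_reg)).
    by apply: continuous_subspaceW; apply: subset_itvl.
  have [|E eE] := @within_continuous_bounded R (fun t => expR (lambda * t)) 0 T (ltW T0).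
    by apply: continuous_subspaceT; exact: continuous_expRM.
  have mdt : measurable_fun `]0, T[ (v_t x).
    apply: open_continuous_measurable_fun => // t.
    by rewrite inE/= in_itv/= => /andP[? _]; exact: cdt'.
  (* Here E bounds the exponential and M bounds u on [0, T]. *)
  apply: (@le_integrable _ _ _ mu _ _ _ (EFin \o (fun t => E * (g t + `|lambda| * M)))) => //.
  + exact/measurable_EFinP.
  + move=> t /=; rewrite in_itv/= => /andP[t0 tT]; rewrite lee_fin.
    have tI : t \in `[0, T] by rewrite in_itv/= !ltW.
    have E0 : 0 <= E by apply: le_trans (eE _ tI).
    have g0 := le_trans (normr_ge0 _) (gb x t xI t0).
    have M0 := le_trans (normr_ge0 _) (uM t tI).
    rewrite [leRHS]ger0_norm; last by rewrite mulr_ge0// addr_ge0// mulr_ge0.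
    rewrite normrM ler_pM//; first exact: eE.
    apply: (le_trans (ler_normD _ _)); rewrite lerD ?gb// normrM ler_wpM2l//.
    exact: uM.
  + have ic : mu.-integrable `]0, T[ (EFin \o (cst (`|lambda| * M))).
      by apply: within_continuous_int; apply: continuous_subspaceT; exact: cst_continuous.
    have h : mu.-integrable `]0, T[ (EFin \o (fun t => g t + `|lambda| * M)).
      have h := @integrableD _ _ _ mu _ (measurable_itv `]0, T[) _ _ (gi T T0) ic.
      by apply: eq_integrable h.
    have := @integrableZl _ _ _ mu _ (measurable_itv `]0, T[) E _ h.
    by apply: eq_integrable.
Qed.

(** The argument of [Gamma] equals gamma; it is left in the form in which [RL_tempered] of order 1 -
    gamma unfolds. *)
Let c := kappa / Gamma (1 - (1 - gamma)).

Let c_ge0 : 0 <= c.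
Proof. by rewrite divr_ge0 ?Gamma_ge0// ltW. Qed.

Let gamma_co : 0 <= gamma < 1.
Proof. by have /andP[/ltW -> ->] := gamma01. Qed.

Let gamma_co' : 0 <= 1 - gamma < 1.
Proof. by have /andP[? ?] := gamma01; apply/andP; split; lra. Qed.

Let v_xx_slice x : x \in `[xl, xr] -> {within `[0, +oo[, continuous (v_xx x)}.
Proof. by move=> xI; exact: (within_continuous_slice1 (A := [set` `[xl, xr]]) xI v_xx_cont). Qed.

(** Multiplication by exp (lambda t) cancels both the tempering factor and the term - lambda u,
    leaving [v_t] = c I' for the convolution I. Hence v - c I is constant at positive times, and
    continuity at 0, where I tends to 0, identifies the constant. *)
Lemma v_volterra x : x \in `]xl, xr[ ->
  (forall t, 0 < t -> RL_tempered_exists (1 - gamma) lambda (dxx xl xr u x) t) ->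
  (forall t, 0 < t -> dt u x t =
     kappa * RL_tempered (1 - gamma) lambda (dxx xl xr u x) t - lambda * u x t) ->
  forall t, 0 < t -> v x t - v x 0 = c * conv (1 - gamma) (v_xx x) t.
Proof.
move=> xI RLe pde t t0.
have xI' : x \in `[xl, xr] by exact: subset_itv_oo_cc xI.
have av := absC1_v xI'; have cv := v_xx_slice xI'.
pose I := conv (1 - gamma) (v_xx x).
have IE : I = RL_integral (1 - gamma) lambda (dxx xl xr u x) by [].
have dI s : 0 < s -> is_derive s 1 I (derive1 I s).
  by move=> s0; rewrite derive1E; apply/derivableP; rewrite IE; exact: (RLe s s0).2.
have v_tE s : 0 < s -> v_t x s = c * derive1 I s.
  move=> s0; rewrite /v_t pde// subrK /RL_tempered -IE.
  have E : expR (lambda * s) * expR (- (lambda * s)) = 1 by rewrite -expRD subrr expR0.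
  rewrite /c -[RHS]mul1r -E.
  by move: (expR _) (expR _) (_^-1) (derive1 _ _) => *; ring.
pose Z : R -> R := v x \- (fun s => c * I s).
have dZ s : 0 < s -> is_derive s 1 Z 0.
  move=> s0; have dv := absC1_derive av s0; have dIs := dI s s0.
  by apply: is_derive_eq; rewrite v_tE// /GRing.scale/= subrr.
have I0 : I 0 = 0 by rewrite /I /conv set_itvoo0 Rintegral_set0.
have cZ : {within `[0, t], continuous Z}.
  apply/continuous_within_itvP => //; split.
  - move=> s; rewrite in_itv/= => /andP[s0 _]; have [+ _] := dZ s s0.
    by move=> /derivable1_diffP; exact: differentiable_continuous.
  - have /(continuous_within_itvP _ t0)[_ v0 _] := absC1_itv (T := t) av.
    apply: cvgB => //=; rewrite I0; apply: cvgM; first exact: cvg_cst.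
    exact: conv_cvg0.
  - apply: cvg_at_left_filter; have [+ _] := dZ t t0.
    by move=> /derivable1_diffP; exact: differentiable_continuous.
have [|s _] := @MVT R Z (cst 0) 0 t t0 _ cZ.
  by move=> s; rewrite in_itv/= => /andP[s0 _]; exact: dZ.
rewrite mul0r /Z/= I0 mulr0 subr0 => /eqP; rewrite subr_eq0 => /eqP <-.
by rewrite opprB addrCA subrr addr0.
Qed.

(** The energy inequality with both exponents equal to gamma, where the weights become 1. The
    inversion introduces the same positive beta factor on the other side, and it cancels. *)
Lemma v_sqr_le x T : x \in `[xl, xr] -> 0 < T ->
  (forall t, 0 < t -> v x t - v x 0 = c * conv (1 - gamma) (v_xx x) t) ->
  2^-1 * (v x T ^+ 2 - v x 0 ^+ 2) <=
  c * conv (1 - gamma) (fun t => v x t * v_xx x t) T.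
Proof.
move=> xI T0 volt; have av := absC1_v xI.
have /andP[g0 g1] := gamma01.
have ggg : 0 <= gamma <= gamma by rewrite lexx ltW.
have := conv_energy_ge av gamma01 ggg T0.
rewrite (conv_inversion gamma01 T0 av (v_xx_slice xI) volt) subrr !powRr0 !mul1r BetaC.
have B0 := Beta_gt0 gamma_co gamma_co'.
by rewrite mulrCA (mulrC c) -mulrA ler_pM2l.
Qed.

(** The derivative of v v_x is v_x^2 + v v_xx, and the square is dropped. Signs are reversed in [F]
    and [q] because [FTC_le_Rintegral] wants the derivative of F below q. *)
Lemma v_parts t : 0 <= t ->
  \int[mu]_(x in `]xl, xr[) (v x t * v_xx x t) <=
  v xr t * v_x xr t - v xl t * v_x xl t.
Proof.
move=> t0; have tI : [set` `[0, +oo[] t by rewrite /= in_itv/= t0.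
have cv := within_continuous_slice2 tI v_cont.
have cv_x := within_continuous_slice2 tI v_x_cont.
have cv_xx := within_continuous_slice2 tI v_xx_cont.
have dv x : x \in `]xl, xr[ -> is_derive x 1 (v ^~ t) (v_x x t).
  move=> xI; have du : is_derive x 1 (u ^~ t) (dx xl xr u x t).
    apply: is_derive_derivable_within; first exact: nbhs_itvoo_cc.
    by apply: (regular_dx u_reg) => //; exact: subset_itv_oo_cc.
  by apply: is_derive_eq; rewrite /v_x /GRing.scale/=; ring.
have dv_x x : x \in `]xl, xr[ -> is_derive x 1 (v_x ^~ t) (v_xx x t).
  move=> xI; have du : is_derive x 1 ((dx xl xr u) ^~ t) (dxx xl xr u x t).
    apply: is_derive_derivable_within; first exact: nbhs_itvoo_cc.
    by apply: (regular_dxx u_reg) => //; exact: subset_itv_oo_cc.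
  by apply: is_derive_eq; rewrite /v_xx /GRing.scale/=; ring.
pose F : R -> R := \- ((v ^~ t) \* (v_x ^~ t)).
pose q : R -> R := \- ((v ^~ t) \* (v_xx ^~ t)).
have cq : {within `[xl, xr], continuous q}.
  by move=> x; exact: (continuousN (continuousM (cv x) (cv_xx x))).
have iq : mu.-integrable `]xl, xr[ (EFin \o q).
  apply: (@integrableS _ _ _ mu `[xl, xr] `]xl, xr[) => //; first exact: subset_itv_oo_cc.
  by apply: continuous_compact_integrable => //; exact: segment_compact.
have : F xr - F xl <= \int[mu]_(x in `]xl, xr[) q x.
  apply: (@FTC_le_Rintegral _ F (fun x => - (v_x x t ^+ 2 + v x t * v_xx x t))).
  - exact: xl_lt_xr.
  - exact: iq.
  - by move=> x; exact: within_continuous_continuous.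
  - by move=> x; exact: (continuousN (continuousM (cv x) (cv_x x))).
  - move=> x xI; have ? := dv x xI; have ? := dv_x x xI.
    by apply: is_derive_eq; rewrite /GRing.scale/=; ring.
  - by move=> x xI; rewrite /q/= lerN2 lerDr sqr_ge0.
have -> : \int[mu]_(x in `]xl, xr[) q x = - \int[mu]_(x in `]xl, xr[) (v x t * v_xx x t).
  rewrite -mulN1r -RintegralZl//.
    by apply: eq_Rintegral => x _; rewrite mulN1r.
  have := integrableN iq.
  by apply: eq_integrable => // x _ /=; rewrite opprK.
by rewrite /F/=; lra.
Qed.

(** Since gamma / 2 < gamma, the value at time T enters with coefficient 0^(gamma/2) = 0, and the
    value at time 0 vanishes by assumption. The flux is a nonpositive multiple of this quantity. *)
Lemma boundary_flux_le0 x T : 0 < T -> x \in `[xl, xr] -> v x 0 = 0 ->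
  0 <= conv (1 - gamma) (fun t => v x t * conv (gamma / 2) (v_t x) t) T.
Proof.
move=> T0 xI v0; have /andP[g0 g1] := gamma01.
have g2 : 0 <= gamma / 2 <= gamma by apply/andP; split; lra.
apply: le_trans (conv_energy_ge (absC1_v xI) gamma01 g2 T0).
rewrite v0 expr0n/= mulr0 subr0 powR0; last by rewrite gt_eqF//; lra.
by rewrite mul0r !mulr0.
Qed.

Lemma Caputo_vE x t : x \in `[xl, xr] ->
  Caputo_tempered (gamma / 2) lambda (u x) t =
  expR (- (lambda * t)) / Gamma (1 - gamma / 2) * conv (gamma / 2) (v_t x) t.
Proof.
move=> xI; congr (_ * _); apply: eq_Rintegral => s; rewrite inE/= in_itv/= => /andP[s0 _].
rewrite /Caputo_integrand derive1E; have [_ dE] := absC1_derive (absC1_v xI) s0.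
by rewrite -dE.
Qed.

Lemma boundary_term_int x T : 0 < T -> x \in `[xl, xr] ->
  mu.-integrable `]0, T[ (EFin \o (fun t =>
    v x t * conv (gamma / 2) (v_t x) t / (T - t) `^ (1 - gamma))).
Proof.
move=> T0 xI; have av := absC1_v xI; have /andP[g0 g1] := gamma01.
have g2 : 0 <= gamma / 2 < 1 by apply/andP; split; lra.
have g3 : 1 - gamma + gamma / 2 <= 1 by lra.
have := absC1M_int av T0 (integrable_conv_conv gamma_co' g2 g3 (absC1_int av T0)).
by apply: eq_integrable => // t _ /=; rewrite mulrA.
Qed.

Hypothesis RL_exists : forall x t, x \in `]xl, xr[ -> 0 < t ->
  RL_tempered_exists (1 - gamma) lambda (dxx xl xr u x) t.
Hypothesis pde : forall x t, x \in `]xl, xr[ -> 0 < t ->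
  dt u x t = kappa * RL_tempered (1 - gamma) lambda (dxx xl xr u x) t - lambda * u x t.
Hypothesis boundary_l : forall t, 0 < t ->
  dx xl xr u xl t = (Num.sqrt kappa)^-1 * Caputo_tempered (gamma / 2) lambda (u xl) t.
Hypothesis boundary_r : forall t, 0 < t ->
  dx xl xr u xr t = - (Num.sqrt kappa)^-1 * Caputo_tempered (gamma / 2) lambda (u xr) t.
Hypotheses (v_l0 : v xl 0 = 0) (v_r0 : v xr 0 = 0).

Let xlI : xl \in `[xl, xr].
Proof. by rewrite in_itv/= lexx ltW. Qed.

Let xrI : xr \in `[xl, xr].
Proof. by rewrite in_itv/= lexx ltW. Qed.

Let C := (Num.sqrt kappa)^-1 / Gamma (1 - gamma / 2).

Let expRM_cancel t : expR (lambda * t) * expR (- (lambda * t)) = 1.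
Proof. by rewrite -expRD subrr expR0. Qed.

Let v_x_l t : 0 < t -> v_x xl t = C * conv (gamma / 2) (v_t xl) t.
Proof.
move=> t0; rewrite /v_x boundary_l// Caputo_vE// /C -[RHS]mul1r -(expRM_cancel t).
by move: (expR _) (expR _) (Gamma _)^-1 (Num.sqrt _)^-1 (conv _ _ _) => *; ring.
Qed.

Let v_x_r t : 0 < t -> v_x xr t = - (C * conv (gamma / 2) (v_t xr) t).
Proof.
move=> t0; rewrite /v_x boundary_r// Caputo_vE// /C -[RHS]mul1r -(expRM_cancel t).
by move: (expR _) (expR _) (Gamma _)^-1 (Num.sqrt _)^-1 (conv _ _ _) => *; ring.
Qed.

(** The opposite signs in the two boundary conditions match the opposite orientations of the
    endpoints, so both ends contribute -C times a nonnegative quantity. *)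
Lemma flux_le0 T : 0 < T ->
  conv (1 - gamma) (fun t => v xr t * v_x xr t - v xl t * v_x xl t) T <= 0.
Proof.
move=> T0; pose k t : R := (T - t) `^ (1 - gamma).
pose A x t : R := v x t * conv (gamma / 2) (v_t x) t / k t.
have iAr := boundary_term_int T0 xrI; have iAl := boundary_term_int T0 xlI.
have -> : conv (1 - gamma) (fun t => v xr t * v_x xr t - v xl t * v_x xl t) T =
    - C * \int[mu]_(t in `]0, T[) (A xr t + A xl t).
  rewrite -RintegralZl//; last first.
    have := @integrableD _ _ _ mu _ (measurable_itv `]0, T[) _ _ iAr iAl.
    by apply: eq_integrable => // t _; rewrite /= EFinD.
  apply: eq_Rintegral => t; rewrite inE/= in_itv/= => /andP[t0 _].
  by rewrite v_x_l// v_x_r// /A /k; ring.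
rewrite RintegralD; [|exact: measurable_itv|exact: iAr|exact: iAl].
rewrite mulNr oppr_le0; apply: mulr_ge0.
  by rewrite divr_ge0 ?Gamma_ge0// invr_ge0 sqrtr_ge0.
by rewrite addr_ge0//; exact: boundary_flux_le0.
Qed.

Lemma v_energy T : 0 < T ->
  \int[mu]_(x in `]xl, xr[) (v x T ^+ 2) <= \int[mu]_(x in `]xl, xr[) (v x 0 ^+ 2).
Proof.
move=> T0; have /andP[_ g1'] := gamma_co'.
have cw : {within `[xl, xr] `*` `[0, +oo[,
    continuous (fun p : R * R => v p.1 p.2 * v_xx p.1 p.2)}.
  by move=> p; exact: (continuousM (@v_cont p) (@v_xx_cont p)).
have [i1 i2 fub] := conv_Fubini (w := fun x t => v x t * v_xx x t)
  T gamma_co' cw.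
have iv2 t : 0 <= t -> mu.-integrable `]xl, xr[ (EFin \o (fun x => v x t ^+ 2)).
  move=> t0; have tI : [set` `[0, +oo[] t by rewrite /= in_itv/= t0.
  have cv := within_continuous_slice2 tI v_cont.
  apply: (@integrableS _ _ _ mu `[xl, xr] `]xl, xr[) => //; first exact: subset_itv_oo_cc.
  apply: continuous_compact_integrable; first exact: segment_compact.
  rewrite (_ : (fun x => v x t ^+ 2) = (v ^~ t) \* (v ^~ t)).
    by move=> x; exact: (continuousM (cv x) (cv x)).
  by apply/funext => x; rewrite expr2.
have id : mu.-integrable `]xl, xr[ (EFin \o (fun x => v x T ^+ 2 - v x 0 ^+ 2)).
  have := @integrableB _ _ _ mu _ (measurable_itv `]xl, xr[) _ _ (iv2 T (ltW T0)) (iv2 0 (lexx 0)).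
  by apply: eq_integrable => // x _; rewrite /= EFinB.
rewrite -subr_le0 -RintegralB//; [|exact: iv2 (ltW T0)|exact: iv2].
suff : 2^-1 * \int[mu]_(x in `]xl, xr[) (v x T ^+ 2 - v x 0 ^+ 2) <= 0.
  by rewrite pmulr_rle0// invr_gt0.
rewrite -RintegralZl//.
apply: (@le_trans _ _ (\int[mu]_(x in `]xl, xr[)
    (c * conv (1 - gamma) (fun t => v x t * v_xx x t) T))).
  apply: le_Rintegral => //.
  - have := @integrableZl _ _ _ mu _ (measurable_itv `]xl, xr[) 2^-1 _ id.
    by apply: eq_integrable.
  - have := @integrableZl _ _ _ mu _ (measurable_itv `]xl, xr[) c _ i1.
    by apply: eq_integrable.
  move=> x xI; apply: v_sqr_le => //; first exact: subset_itv_oo_cc xI.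
  by apply: v_volterra => // t t0; [exact: RL_exists|exact: pde].
(* Once the integrals are exchanged, integration by parts in space applies at each fixed time, and
   the nonnegative kernel preserves the inequality. *)
rewrite RintegralZl// fub mulr_ge0_le0//; apply: le_trans (flux_le0 T0).
have cl := within_continuous_slice1 (A := [set` `[xl, xr]]) xlI v_cont.
have cr := within_continuous_slice1 (A := [set` `[xl, xr]]) xrI v_cont.
have cxl := within_continuous_slice1 (A := [set` `[xl, xr]]) xlI v_x_cont.
have cxr := within_continuous_slice1 (A := [set` `[xl, xr]]) xrI v_x_cont.
apply: le_Rintegral; [exact: measurable_itv|exact: i2| |].
  apply: within_continuous_conv_int => // t.
  exact: (continuousB (continuousM (cr t) (cxr t)) (continuousM (cl t) (cxl t))).
move=> t; rewrite /= in_itv/= => /andP[t0 _].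
by rewrite ler_wpM2r ?invr_ge0 ?powR_ge0// v_parts// ltW.
Qed.

End solution.

(** * Exponential weight, boundary values at time 0, measurability of the norm in time *)

Section final_estimates.
Context {R : realType}.
Local Notation mu := (@lebesgue_measure R).

(** Up to the factor r, the integrand is the density of the exponential law, of total mass 1. *)
Lemma integral_expRN (r : R) : 0 < r ->
  (\int[mu]_(t in `[0%R, +oo[) (expR (- (r * t)))%:E = (r^-1)%:E)%E.
Proof.
move=> r0; have me : measurable_fun setT (fun t : R => expR (- (r * t))).
  by apply: measurableT_comp => //; apply: measurableT_comp => //; exact: measurable_funM.
have E : (r%:E * \int[mu]_(t in `[0%R, +oo[) (expR (- (r * t)))%:E = 1)%E.
  rewrite -ge0_integralZl//; first last.
  - by rewrite lee_fin ltW.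
  - by apply/measurable_EFinP; exact: measurable_funTS.
  rewrite -(integral_exponential_pdf r0) integral_mkcond.
  apply: eq_integral => t _; rewrite /exponential_pdf !patchE.
  by case: ifP => // _; rewrite -EFinM mulNr.
by rewrite -[LHS]mul1e -(@mulVf _ r) ?gt_eqF// EFinM -muleA E mule1.
Qed.

(** The closed support misses the endpoints, so u0 vanishes near them; as w agrees with u0 only
    inside, its endpoint values are found as one-sided limits. *)
Lemma support_boundary0 (xl xr : R) (u0 : R -> R) (w : R -> R) : xl < xr ->
  closed_support u0 `<=` `]xl, xr[ ->
  {within `[xl, xr], continuous w} -> (forall x, x \in `]xl, xr[ -> w x = u0 x) ->
  w xl = 0 /\ w xr = 0.
Proof.
move=> xlr su0 cw wu0; have /(continuous_within_itvP _ xlr)[_ wl wr] := cw.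
have near0 y : y \notin `]xl, xr[ -> \forall x \near y, u0 x = 0.
  move=> yI; have : ~ closed_support u0 y by move=> /su0; exact/negP.
  move=> /existsNP[B] /not_implyP[nB] /set0P/negP/negPn/eqP B0.
  apply: filterS nB => x Bx; apply/eqP/negPn/negP => u0x.
  by have : set0 x by rewrite -B0.
split.
- suff h : w x @[x --> xl^'+] --> 0 by exact: (cvg_unique _ wl h).
  apply: cvg_near_cst.
  near=> x; rewrite wu0.
    by near: x; apply: cvg_within; apply: near0; rewrite in_itv/= ltxx.
  by rewrite in_itv/=; apply/andP; split; near: x; [exact: nbhs_right_gt|exact: nbhs_right_lt].
- suff h : w x @[x --> xr^'-] --> 0 by exact: (cvg_unique _ wr h).
  apply: cvg_near_cst.
  near=> x; rewrite wu0.
    by near: x; apply: cvg_within; apply: near0; rewrite in_itv/= ltxx andbF.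
  by rewrite in_itv/=; apply/andP; split; near: x; [exact: nbhs_left_gt|exact: nbhs_left_lt].
Unshelve. all: by end_near. Qed.

(** Tonelli's theorem for the square of [w] extended by 0 outside the strip. *)
Lemma measurable_sqnormL2 (xl xr : R) (w : R -> R -> R) :
  {within `[xl, xr] `*` `[0, +oo[, continuous (fun p => w p.1 p.2)} ->
  measurable_fun (`[0%R, +oo[%classic : set R) (fun t => sqnormL2 xl xr (w ^~ t)).
Proof.
move=> cw; pose D : set (R * R) := `]xl, xr[ `*` `[0, +oo[.
pose W (p : R * R) : R := ((fun p => w p.1 p.2) \_ D) p ^+ 2.
have mD : measurable D by apply: measurableX; exact: measurable_itv.
have mW : measurable_fun setT W.
  apply: measurable_funX; apply/(measurable_restrictT _ _).1 => //.
  apply: within_continuous_measurable_prod => //.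
  by apply: continuous_subspaceW cw; apply: setSX => //; exact: subset_itv_oo_cc.
have mI : measurable_fun setT (fun t => \int[mu]_x (W (x, t))%:E)%E.
  apply: (measurable_fun_fubini_tonelli_G (m1 := mu) (EFin \o W)).
    exact/measurable_EFinP.
  by move=> p; rewrite lee_fin sqr_ge0.
apply: (eq_measurable_fun (fun t => \int[mu]_x (W (x, t))%:E)%E); last exact: measurable_funTS.
move=> t; rewrite inE => tI; rewrite /sqnormL2 [RHS]integral_mkcond.
apply: eq_integral => x _; rewrite /W !patchE.
have [xI|xI] := boolP (x \in `]xl, xr[%classic); last first.
  rewrite ifF ?expr0n//; apply/negP; rewrite inE => -[/= xI' _].
  by move: xI; rewrite notin_setE.
by rewrite mem_set//; split => //; move: xI; rewrite inE.
Qed.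

End final_estimates.

Unset Implicit Arguments.

Theorem theorem1 (R : realType) (gamma kappa lambda xl xr : R)
    (u0 : R -> R) (u : R -> R -> R)
    (gamma01 : 0 < gamma < 1) (kappa_gt0 : 0 < kappa) (lambda_ge0 : 0 <= lambda)
    (xl_lt_xr : xl < xr)
    (supp_u0 : closed_support u0 `<=` `]xl, xr[)
    (u_reg : spacetime_regular xl xr u)
    (RL_exists : forall x t, x \in `]xl, xr[ -> 0 < t ->
      RL_tempered_exists (1 - gamma) lambda (dxx xl xr u x) t)
    (Caputo_exists_l : forall t, 0 < t ->
      Caputo_tempered_exists (gamma / 2) lambda (u xl) t)
    (Caputo_exists_r : forall t, 0 < t ->
      Caputo_tempered_exists (gamma / 2) lambda (u xr) t)
    (pde : forall x t, x \in `]xl, xr[ -> 0 < t ->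
      dt u x t = kappa * RL_tempered (1 - gamma) lambda (dxx xl xr u x) t
                 - lambda * u x t)
    (initial : forall x, x \in `]xl, xr[ -> u x 0 = u0 x)
    (boundary_l : forall t, 0 < t ->
      dx xl xr u xl t =
        (Num.sqrt kappa)^-1 * Caputo_tempered (gamma / 2) lambda (u xl) t)
    (boundary_r : forall t, 0 < t ->
      dx xl xr u xr t =
        - (Num.sqrt kappa)^-1 * Caputo_tempered (gamma / 2) lambda (u xr) t)
    (s0 : R) (s0_gt0 : 0 < s0) :
  (\int[@lebesgue_measure R]_(t in `[0%R, +oo[)
      ((expR (- (2 * s0 * t)))%:E * sqnormL2 xl xr (u ^~ t))
    <= ((2 * s0)^-1)%:E * sqnormL2 xl xr u0)%E.
Proof.
have cu := regular_cont u_reg.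
have cut (t : R) : 0 <= t -> {within `[xl, xr], continuous (u ^~ t)}.
  move=> t0; apply: (within_continuous_slice2 (B := [set` `[0, +oo[]) _ cu).
  by rewrite /= in_itv/= t0.
have [ul0 ur0] := support_boundary0 xl_lt_xr supp_u0 (cut 0 (lexx 0)) initial.
have expR0M x : expR (lambda * 0) * u x 0 = u x 0 by rewrite mulr0 expR0 mul1r.
have iu (k t : R) : 0 <= t ->
    lebesgue_measure.-integrable `]xl, xr[ (EFin \o (fun x => (k * u x t) ^+ 2)).
  move=> t0; apply: (@integrableS _ _ _ lebesgue_measure `[xl, xr] `]xl, xr[) => //.
    exact: subset_itv_oo_cc.
  apply: continuous_compact_integrable; first exact: segment_compact.
  have ck : {within `[xl, xr], continuous (cst k \* (u ^~ t))}.
    by move=> x; exact: (continuousM (@cst_continuous _ _ k _) (cut t t0 x)).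
  rewrite (_ : (fun x => _) = (cst k \* (u ^~ t)) \* (cst k \* (u ^~ t))).
    by move=> x; exact: (continuousM (ck x) (ck x)).
  by apply/funext => x; rewrite expr2.
have iu1 (t : R) : 0 <= t ->
    lebesgue_measure.-integrable `]xl, xr[ (EFin \o (fun x => u x t ^+ 2)).
  move=> t0; have := iu 1 t t0.
  by apply: eq_integrable => // x _; rewrite /= mul1r.
have sqE (t : R) : 0 <= t -> sqnormL2 xl xr (u ^~ t) =
    (\int[lebesgue_measure]_(x in `]xl, xr[) (u x t ^+ 2))%:E.
  by move=> t0; rewrite /Rintegral fineK//; apply: integrable_fin_num => //; exact: iu1.
have u0E : sqnormL2 xl xr u0 = sqnormL2 xl xr (u ^~ 0).
  by apply: eq_integral => x; rewrite inE => xI; rewrite initial.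
have le_u0 (t : R) : 0 <= t -> (sqnormL2 xl xr (u ^~ t) <= sqnormL2 xl xr u0)%E.
  rewrite le_eqVlt u0E => /predU1P[<-//|t0].
  have t0' := ltW t0.
  rewrite !sqE// lee_fin.
  have vl0 : expR (lambda * 0) * u xl 0 = 0 by rewrite expR0M.
  have vr0 : expR (lambda * 0) * u xr 0 = 0 by rewrite expR0M.
  have := v_energy gamma01 kappa_gt0 xl_lt_xr u_reg RL_exists pde boundary_l boundary_r vl0 vr0 t0.
  under [X in _ <= X -> _]eq_Rintegral do rewrite expR0M.
  (* For lambda and t nonnegative the factor exp (lambda t) is at least 1, so the norm of u is at
     most that of exp (lambda t) u, with equality at time 0. *)
  apply: le_trans; apply: le_Rintegral => //; [exact: iu1|exact: iu|].
  move=> x _; rewrite exprMn ler_peMl ?sqr_ge0// expr_ge1 ?expR_ge0//.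
  by rewrite -expR0 ler_expR mulr_ge0.
have me : measurable_fun setT (fun t : R => expR (- (2 * s0 * t))).
  by apply: measurableT_comp => //; apply: measurableT_comp => //; exact: measurable_funM.
have sq0 w : (0 <= sqnormL2 xl xr w)%E.
  by apply: integral_ge0 => x _; rewrite lee_fin sqr_ge0.
apply: (@le_trans _ _ (\int[lebesgue_measure]_(t in `[0%R, +oo[)
    ((expR (- (2 * s0 * t)))%:E * sqnormL2 xl xr u0))%E).
  apply: ge0_le_integral => //.
  - by move=> t _; rewrite mule_ge0// lee_fin expR_ge0.
  - apply: emeasurable_funM; last exact: measurable_sqnormL2.
    by apply/measurable_EFinP; exact: measurable_funTS.
  - apply: emeasurable_funM => //.
    by apply/measurable_EFinP; exact: measurable_funTS.
  move=> t; rewrite /= in_itv/= andbT => t0.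
  by rewrite lee_wpmul2l ?lee_fin ?expR_ge0// le_u0.
rewrite u0E sqE// ge0_integralZr//; first last.
- by rewrite -sqE.
- by apply/measurable_EFinP; exact: measurable_funTS.
by rewrite integral_expRN ?mulr_gt0.
Qed.
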